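(* Let $\alpha\in(0,1)$ and let $\Omega\subset\mathbb R^n$ be an open set. If $(E_k)_{k\in\mathbb N}$ is a sequence of sets with finite fractional Caccioppoli $\alpha$-perimeter in $\Omega$ and $\chi_{E_k}\to\chi_E$ in $L^1_{\mathrm{loc}}(\mathbb R^n)$, then $$D^\alpha\chi_{E_k}\rightharpoonup D^\alpha\chi_E\quad\text{in }\mathcal M(\Omega;\mathbb R^n),$$ and $$|D^\alpha\chi_E|(\Omega)\le\liminf_{k\to+\infty}|D^\alpha\chi_{E_k}|(\Omega).$$
   Context: For $\alpha\in(0,1)$ let $\mu_{n,\alpha}:=2^\alpha\pi^{-n/2}\,\Gamma\big(\tfrac{n+\alpha+1}{2}\big)/\Gamma\big(\tfrac{1-\alpha}{2}\big)$. For $\varphi\in C^\infty_c(\mathbb R^n;\mathbb R^n)$ the fractional $\alpha$-divergence is $$\mathrm{div}^\alpha\varphi(x):=\mu_{n,\alpha}\int_{\mathbb R^n}\frac{(y-x)\cdot(\varphi(y)-\varphi(x))}{|y-x|^{n+\alpha+1}}\,dy,$$ which is a function in $L^1(\mathbb R^n)\cap L^\infty(\mathbb R^n)$. For a measurable set $E\subset\mathbb R^n$ and an open set $\Omega\subset\mathbb R^n$, the fractional Caccioppoli $\alpha$-perimeter of $E$ in $\Omega$ is $$|D^\alpha\chi_E|(\Omega):=\sup\Big\{\int_E\mathrm{div}^\alpha\varphi\,dx:\ \varphi\in C^\infty_c(\Omega;\mathbb R^n),\ \|\varphi\|_{L^\infty(\Omega;\mathbb R^n)}\le1\Big\};$$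 $E$ has finite fractional Caccioppoli $\alpha$-perimeter in $\Omega$ if this is finite. $\mathcal M(\Omega;\mathbb R^n)$ denotes the space of finite $\mathbb R^n$-valued Radon measures on $\Omega$, and $\rightharpoonup$ denotes weak convergence of Radon measures. A measurable set $E$ has finite fractional Caccioppoli $\alpha$-perimeter in $\Omega$ if and only if there is a measure $D^\alpha\chi_E\in\mathcal M(\Omega;\mathbb R^n)$ such that $\int_E\mathrm{div}^\alpha\varphi\,dx=-\int_\Omega\varphi\cdot dD^\alpha\chi_E$ for all $\varphi\in C^\infty_c(\Omega;\mathbb R^n)$; in that case the total variation of $D^\alpha\chi_E$ on $\Omega$ is the fractional Caccioppoli $\alpha$-perimeter $|D^\alpha\chi_E|(\Omega)$.
   Formalization: Weak convergence on C_c is proved if D^αχ_E is a measure in Ω and the α-perimeters of E_k are bounded in each open U compactly contained in Ω (else false: many tiny balls); with no extra assumption, convergence to −∫_E div^α φ is proved for φ in C_c^∞(Ω;R^n). *)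

(* Defs.v *)
From HB Require Import structures.
From mathcomp Require Import all_boot all_order all_algebra.
From mathcomp Require Import all_classical all_reals all_analysis.
From mathcomp Require Import measurable_realfun ess_sup_inf.

Set Implicit Arguments.
Unset Strict Implicit.
Unset Printing Implicit Defensive.
Import Order.TTheory GRing.Theory Num.Theory.
Import numFieldNormedType.Exports.

Local Open Scope classical_set_scope.
Local Open Scope ring_scope.

(* R^n is 'rV[R]_n; its measurable sets are the Borel sets. *)

HB.instance Definition _ (R : realType) (n : nat) :=
  @isMeasurable.Build (sigma_display (@open 'rV[R]_n)) 'rV[R]_n
    <<s @open 'rV[R]_n >> (@sigma_algebra0 _ setT _) (@sigma_algebraC _ _)
    (@sigma_algebra_bigcup _ setT _).

Section lebesgue_rV.
Context {R : realType}.

Lemma open_measurable_rV n (U : set 'rV[R]_n) : open U -> measurable U.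
Proof. exact: sub_sigma_algebra. Qed.

Lemma measurable_coord n (i : 'I_n) :
  measurable_fun setT (fun x : 'rV[R]_n => x 0 i : measurableTypeR R).
Proof.
apply: (measurability _ (RGenOpens.measurableE R)) => _ [_ [a [b ->] <-]].
rewrite setTI; apply: open_measurable_rV.
have /continuousP := @coord_continuous R 1 n 0 i; apply.
exact: interval_open.
Qed.

Lemma measurable_fun_rV d (T : measurableType d) n (f : T -> 'rV[R]_n) :
  (forall i, measurable_fun setT (fun t => f t 0 i : measurableTypeR R)) ->
  measurable_fun setT f.
Proof.
move=> mf; apply: (@measurability _ _ _ _ _ f (@open 'rV[R]_n)) => //.
move=> _ [U oU <-]; rewrite setTI.
pose B (p : {ffun 'I_n -> rat} * nat) : set 'rV[R]_n :=
  \bigcap_(i in [set: 'I_n])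
    [set y | ball (ratr (p.1 i) : R^o) p.2.+1%:R^-1 (y 0 i)].
have -> : f @^-1` U = \bigcup_p (if `[< B p `<=` U >] then f @^-1` B p else set0).
  apply/seteqP; split => [t Uft|t [p _]]; last first.
    by case: asboolP => // BU Bft; exact: BU.
  have /nbhs_ballP[e /= e0 eU] : nbhs (f t) U by exact: open_nbhs_nbhs.
  have [k _ /(_ _ (leqnn k)) /= ke] := near_infty_natSinv_lt (PosNum (divr_gt0 e0 (@ltr0Sn R 1))).
  have k0 : (0 : R) < k.+1%:R^-1 by [].
  have q_ i : {q : rat | ball (f t 0 i : R^o) k.+1%:R^-1 (ratr q : R^o)}.
    apply/cid.
    have [q] : exists q, ratr q \in `](f t 0 i - k.+1%:R^-1), (f t 0 i + k.+1%:R^-1)[.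
      by apply: rat_in_itvoo; rewrite ltrD2l gtrN.
    rewrite in_itv /= => /andP[q1 q2]; exists q.
    by rewrite -ball_normE /= ltr_distlC ltrBlDr -ltrBlDr q1 q2.
  exists ([ffun i => sval (q_ i)], k) => //=.
  have -> : `[< B ([ffun i => sval (q_ i)], k) `<=` U >].
    apply/asboolP => y By; apply: eU; split => // i0 i; rewrite (ord1 i0).
    have := By i I; rewrite /= ffunE => qy.
    have := ball_triangle (svalP (q_ i)) qy.
    by apply: le_ball; rewrite [leRHS]splitr lerD// ltW.
  by move=> i _ /=; rewrite ffunE; apply: ball_sym; exact: (svalP (q_ i)).
apply: countable_bigcupT_measurable => // p.
case: asboolP => // _.
rewrite /B preimage_bigcap; apply: fin_bigcap_measurable => // i _.
rewrite -[X in measurable X]setTI; apply: mf => //.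
by apply: open_measurable; exact: ball_open.
Qed.

Definition cons_rV n (p : measurableTypeR R * 'rV[R]_n) : 'rV[R]_n.+1 :=
  \row_i if unlift 0 i is Some j then p.2 0 j else p.1.

Definition uncons_rV n (x : 'rV[R]_n.+1) : measurableTypeR R * 'rV[R]_n :=
  (x 0 0, \row_i x 0 (lift 0 i)).

Lemma cons_rVK n : cancel (@cons_rV n) (@uncons_rV n).
Proof.
case=> a x; congr pair; first by rewrite mxE unlift_none.
by apply/rowP => i; rewrite !mxE liftK.
Qed.

Lemma uncons_rVK n : cancel (@uncons_rV n) (@cons_rV n).
Proof.
move=> x; apply/rowP => i; rewrite mxE.
by have [j ->|->] := unliftP 0 i; rewrite ?liftK ?unlift_none /= ?mxE.
Qed.

Lemma measurable_cons_rV n : measurable_fun setT (@cons_rV n).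
Proof.
apply: measurable_fun_rV => i; have [j ->|->] := unliftP 0 i.
- rewrite (_ : (fun t => _) =
    (fun x : 'rV[R]_n => x 0 j : measurableTypeR R) \o snd).
    by apply: measurableT_comp => //; exact: measurable_coord.
  by apply/funext => p; rewrite mxE liftK.
- rewrite (_ : (fun t => _) = fst) //.
  by apply/funext => p; rewrite mxE unlift_none.
Qed.

Lemma measurable_uncons_rV n : measurable_fun setT (@uncons_rV n).
Proof.
apply/measurable_fun_pairP; split; first exact: measurable_coord.
apply: measurable_fun_rV => i.
rewrite (_ : (fun t => _) = (fun x : 'rV[R]_n.+1 => x 0 (lift 0 i))).
  exact: measurable_coord.
by apply/funext => x; rewrite mxE.
Qed.

Section lebesgue_rV_rec.
Variables (n : nat) (mu : {sigma_finite_measure set 'rV[R]_n -> \bar R}).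

Definition lebesgue_rV_rec : set 'rV[R]_n.+1 -> \bar R :=
  pushforward (@lebesgue_measure R \x mu)%E (@cons_rV n).

Let rec_measure : {measure set 'rV[R]_n.+1 -> \bar R} :=
  measure_function_pushforward__canonical__measure_function_Measure
    (@lebesgue_measure R \x mu)%E (@measurable_cons_rV n).

Let rec0 : lebesgue_rV_rec set0 = 0%E.
Proof. exact: (measure0 rec_measure). Qed.

Let rec_ge0 A : (0 <= lebesgue_rV_rec A)%E.
Proof. exact: (measure_ge0 rec_measure). Qed.

Let rec_sigma_additive : semi_sigma_additive lebesgue_rV_rec.
Proof. exact: (@measure_semi_sigma_additive _ _ _ rec_measure). Qed.

HB.instance Definition _ :=
  isMeasure.Build _ _ _ lebesgue_rV_rec rec0 rec_ge0 rec_sigma_additive.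

Let rec_sigma_finite : sigma_finite setT lebesgue_rV_rec.
Proof.
have /sigma_finiteP[F [TF ndF Foo]] := sigma_finiteT (@lebesgue_measure R).
have /sigma_finiteP[G [TG ndG Goo]] := sigma_finiteT mu.
exists (fun k => @uncons_rV n @^-1` (F k `*` G k)) => [|k].
  rewrite -preimage_bigcup; apply/seteqP; split => // x _.
  have [i _ Fi] : (\bigcup_k F k) (x 0 0) by rewrite -TF.
  have [j _ Gj] : (\bigcup_k G k) (uncons_rV x).2 by rewrite -TG.
  exists (maxn i j) => //; split.
    by move: Fi; exact/subsetPset/ndF/leq_maxl.
  by move: Gj; exact/subsetPset/ndG/leq_maxr.
have [mF oF] := Foo k; have [mG oG] := Goo k; split.
  rewrite -[X in measurable X]setTI; apply: measurable_uncons_rV => //.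
  exact: measurableX.
rewrite /lebesgue_rV_rec /pushforward -comp_preimage.
rewrite (_ : _ \o _ = id); last by apply/funext => p; exact: cons_rVK.
by rewrite preimage_id product_measure1E// lte_mul_pinfty// ge0_fin_numE.
Qed.

HB.instance Definition _ :=
  Measure_isSigmaFinite.Build _ _ _ lebesgue_rV_rec rec_sigma_finite.

End lebesgue_rV_rec.

Fixpoint lebesgue_rV n : {sigma_finite_measure set 'rV[R]_n -> \bar R} :=
  match n return {sigma_finite_measure set 'rV[R]_n -> \bar R} with
  | 0%N => dirac (0 : 'rV[R]_0)
  | m.+1 => lebesgue_rV_rec (lebesgue_rV m)
  end.

Definition lebesgue_measurable n : set (set 'rV[R]_n) :=
  completed_algebra_gen (lebesgue_rV n).

End lebesgue_rV.

Section vector_fields.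
Context {R : realType} {n : nat}.
Local Notation Rn := 'rV[R]_n.
Local Notation leb := (@lebesgue_rV R n).
Implicit Types (u v x : Rn) (phi : Rn -> Rn) (Omega : set Rn).

Definition dotmul u v : R := \sum_(i < n) u 0 i * v 0 i.

(* The library norm of 'rV[R]_n is the sup norm, with the same topology. *)
Definition enorm u : R := Num.sqrt (dotmul u u).

Definition partial (i : 'I_n) phi : Rn -> Rn :=
  fun x => 'D_(delta_mx 0 i) phi x.

Definition iter_partial (s : seq 'I_n) phi : Rn -> Rn := foldr partial phi s.

Definition smooth phi : Prop :=
  forall s : seq 'I_n, continuous (iter_partial s phi) /\
    forall (i : 'I_n) x, derivable (iter_partial s phi) x (delta_mx 0 i).

Definition tsupport phi : set Rn := closure [set x | phi x != 0].

(* Vector fields on Omega with compact support in Omega are identified with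
   their extension by zero to R^n. *)
Definition Cc Omega : set (Rn -> Rn) :=
  [set phi | [/\ continuous phi, compact (tsupport phi)
               & tsupport phi `<=` Omega]].

Definition Cc_infty Omega : set (Rn -> Rn) :=
  [set phi | [/\ smooth phi, compact (tsupport phi)
               & tsupport phi `<=` Omega]].

Definition Linfty_norm Omega phi : \bar R :=
  ess_sup leb ((EFin \o enorm \o phi) \_ Omega).

End vector_fields.

Section fractional_perimeter.
Context {R : realType} {n : nat}.
Local Notation Rn := 'rV[R]_n.
Local Notation leb := (@lebesgue_rV R n).
Implicit Types (alpha : R) (E Omega : set Rn) (phi : Rn -> Rn).

Definition Gamma (s : R) : R :=
  \int[@lebesgue_measure R]_(t in `]0, +oo[) (t `^ (s - 1) * expR (- t)).

Definition frac_const alpha : R :=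
  2 `^ alpha * pi `^ (- (n%:R / 2)) *
  (Gamma ((n%:R + alpha + 1) / 2) / Gamma ((1 - alpha) / 2)).

Definition frac_div alpha phi : Rn -> R := fun x =>
  frac_const alpha *
  \int[leb]_y (dotmul (y - x) (phi y - phi x) /
               enorm (y - x) `^ (n%:R + alpha + 1)).

(* For E Lebesgue measurable but not Borel, the library integral over E (a
   supremum over Borel simple functions, separately for the positive and the
   negative part of the integrand) is the Lebesgue integral over E. *)
Definition int_frac_div alpha E phi : R := \int[leb]_(x in E) frac_div alpha phi x.

Definition frac_perimeter alpha Omega E : \bar R :=
  ereal_sup [set (int_frac_div alpha E phi)%:E | phi in
    [set phi | Cc_infty Omega phi /\ (Linfty_norm Omega phi <= 1)%E]].

Definition finite_frac_perimeter alpha Omega E : Prop :=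
  (frac_perimeter alpha Omega E < +oo)%E.

(* R^n-valued Borel measure on R^n; charges are finite by definition. *)
Definition vmeasure := 'I_n -> {charge set Rn -> \bar R}.

(* A finite R^n-valued Radon measure on the open set Omega is a finite Borel
   one, identified with its extension by zero to R^n. *)
Definition radon_on Omega (mu : vmeasure) : Prop :=
  forall i A, measurable A -> A `&` Omega = set0 -> mu i A = 0%E.

Definition hahn_pn (mu : {charge set Rn -> \bar R}) :
    {PN : set Rn * set Rn | hahn_decomposition mu PN.1 PN.2}.
Proof.
by apply: cid; have [P [N PN]] := Hahn_decomposition mu; exists (P, N).
Qed.

Definition charge_integral Omega (mu : {charge set Rn -> \bar R}) (f : Rn -> R) : R :=
  \int[jordan_pos (svalP (hahn_pn mu))]_(x in Omega) f x -
  \int[jordan_neg (svalP (hahn_pn mu))]_(x in Omega) f x.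

Definition vintegral Omega phi (mu : vmeasure) : R :=
  \sum_(i < n) charge_integral Omega (mu i) (fun x => phi x 0 i).

(* mu is the measure D^alpha chi_E on Omega *)
Definition is_frac_variation alpha Omega E (mu : vmeasure) : Prop :=
  radon_on Omega mu /\
  forall phi, Cc_infty Omega phi ->
    int_frac_div alpha E phi = - vintegral Omega phi mu.

Definition weak_cvg Omega (mu_ : nat -> vmeasure) (mu : vmeasure) : Prop :=
  forall phi, Cc Omega phi ->
    vintegral Omega phi (mu_ k) @[k --> \oo] --> vintegral Omega phi mu.

Definition cvg_L1loc (f_ : nat -> Rn -> R) (f : Rn -> R) : Prop :=
  forall K : set Rn, compact K ->
    (\int[leb]_(x in K) `|f_ k x - f x|%:E)%E @[k --> \oo] --> 0%E.

End fractional_perimeter.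

(* Main.v *)
Require Import Defs.
From HB Require Import structures.
From mathcomp Require Import all_boot all_order all_algebra.
From mathcomp Require Import all_classical all_reals all_analysis.
From mathcomp Require Import measurable_realfun ess_sup_inf ring lra.

Set Implicit Arguments.
Unset Strict Implicit.
Unset Printing Implicit Defensive.
Import Order.TTheory GRing.Theory Num.Theory.
Import numFieldNormedType.Exports.

Local Open Scope classical_set_scope.
Local Open Scope ring_scope.

(* For a smooth compactly supported field phi, the integrand of div^alpha phi is
   dominated by a multiple of |y - x|^(-n-alpha) min(|y - x|, 1), and vanishes
   unless x or y lies in the support. Summing over dyadic shells, the
   integral of this kernel in y is bounded uniformly in x, so div^alpha phi is
   bounded, and by Tonelli's theorem it is integrable. Hence E |-> int_E div^alpha
   phi is continuous for L^1_loc convergence of sets: outside a large ball the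
   integral is small, inside it the integrand is bounded. This gives the
   convergence against smooth fields, and the lower semicontinuity of the
   perimeter as a supremum of continuous functionals.

   For convergence against a continuous field phi, choose U relatively compact
   in Omega around the support of phi. Smooth fields supported in U are
   uniformly dense (interpolate on a fine grid with a smooth partition of unity),
   so a bound on the perimeters in U bounds the functionals int phi . dD^alpha
   chi_{E_k} uniformly in k for the sup norm, and density concludes. *)

(** * Smooth functions of one variable *)

Section derivative_towers.
Context {R : realType}.
Implicit Types (f : R -> R) (D F G : nat -> R -> R).

(** Keeping all derivatives as explicit functions makes the iterated partial derivatives required by
    [smooth] computable in closed form, as in [iter_partial_sepvar]. *)
Definition tower D := forall k (x : R), is_derive x 1 (D k) (D k.+1 x).

Lemma is_derive_cvg (V W : normedModType R) (f : V -> W) (x v : V) (df : W) :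
  h^-1 *: (f (h *: v + x) - f x) @[h --> 0^'] --> df -> is_derive x v f df.
Proof.
move=> fx; apply: DeriveDef; last exact: cvg_lim fx.
by apply/cvg_ex; exists df.
Qed.

Lemma is_derive1P (V W : normedModType R) (f : V -> W) (x v : V) (df : W) :
  is_derive (0 : R) 1 (fun h : R => f (h *: v + x)) df -> is_derive x v f df.
Proof.
move=> [fd <-]; apply: DeriveDef; first by apply/derivable1P.
rewrite /derive; set g1 := fun h => h^-1 *: _; set g2 := fun h => h^-1 *: _.
suff -> : g1 = g2 by []; apply/funext => h; rewrite /g1 /g2 /=.
by rewrite addr0 scale0r add0r -[h *: 1]/(h * 1) mulr1.
Qed.

Lemma is_derive_scalel (W : normedModType R) (f : R -> R) (x df : R) (w : W) :
  is_derive x 1 f df -> is_derive x 1 (fun t => f t *: w) (df *: w).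
Proof.
move=> [fd <-]; apply: is_derive_cvg.
rewrite (_ : (fun h => _) = fun h => (h^-1 *: (f (h *: 1 + x) - f x)) *: w); last first.
  by apply/funext => h; rewrite -scalerBl scalerA.
exact: cvgZr_tmp.
Qed.

Lemma is_derive_bigsum (V W : normedModType R) (I : finType) (f : I -> V -> W)
    (df : I -> W) (x v : V) :
  (forall i, is_derive x v (f i) (df i)) ->
  is_derive x v (fun t => \sum_i f i t) (\sum_i df i).
Proof.
move=> fd; rewrite (_ : (fun t => _) = \sum_i f i); last first.
  by apply/funext => t; rewrite fct_sumE.
elim/big_ind2 : _ => // [|f1 d1 f2 d2 h1 h2]; first exact: is_derive_cst.
exact: is_deriveD.
Qed.

Lemma is_derive1_comp_affine f (df a b x : R) :
  is_derive (a * x + b) 1 f df -> is_derive x 1 (fun t => f (a * t + b)) (a * df).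
Proof.
move=> fd.
have ad : is_derive x 1 (fun t : R => a * t + b : R) a.
  have -> : (fun t : R => a * t + b : R) = (a *: id) + cst b by [].
  by apply: is_derive_eq; rewrite addr0 -[RHS]mulr1.
by rewrite mulrC; exact: (is_derive1_comp (f := f) (g := fun t : R => a * t + b)).
Qed.

Lemma tower_affine D (a b : R) :
  tower D -> tower (fun k t => a ^+ k * D k (a * t + b)).
Proof.
move=> tD k x.
have := is_derive1_comp_affine (tD k (a * x + b)).
move=> h; have -> : (fun t => a ^+ k * D k (a * t + b)) =
  (a ^+ k) *: (fun t => D k (a * t + b)) by [].
by apply: is_derive_eq; rewrite exprSr -[LHS]/(_ * _); ring.
Qed.

Lemma towerB F G : tower F -> tower G -> tower (fun k => F k - G k).
Proof. by move=> tF tG k x; have := tF k x; have := tG k x => ? ?; exact: is_deriveB. Qed.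

(* The k-th derivative of F i * G j; expanding it by recursion instead of by
   Leibniz' formula spares the binomial coefficients. *)
Fixpoint leibniz F G (k i j : nat) : R -> R :=
  if k is k'.+1 then leibniz F G k' i.+1 j + leibniz F G k' i j.+1
  else F i * G j.

Lemma tower_leibniz F G : tower F -> tower G ->
  tower (fun k => leibniz F G k 0 0).
Proof.
move=> tF tG k.
suff H i j (x : R) : is_derive x 1 (leibniz F G k i j) (leibniz F G k.+1 i j x).
  by move=> x; exact: H.
elim: k i j x => [|k IH] i j x.
  apply: is_derive_eq (is_deriveM (tF i x) (tG j x)) _.
  by rewrite -[LHS]/(F i x * G j.+1 x + G j x * F i.+1 x) addrC mulrC.
by have ? := IH i j.+1 x; have ? := IH i.+1 j x; exact: is_deriveD.
Qed.

(** With u = 1/t, differentiation in t sends p(u) exp(-u) to u^2 (p - p')(u) exp(-u); hence the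
    recursion for the derivatives of exp(-1/t). *)
Fixpoint expinv_poly k : {poly R} :=
  if k is k'.+1 then 'X^2 * (expinv_poly k' - (expinv_poly k')^`()) else 1.

Definition expinv k (t : R) : R :=
  if 0 < t then (expinv_poly k).[t^-1] * expR (- t^-1) else 0.

(** The square makes the difference quotients of [expinv] at 0 tend to 0. With d = [size p] and u =
    1/t >= 1, |p(u)| is at most u^d times the sum of the absolute values of the coefficients, while
    exp(u) >= u^(d+2) / (d+2)!. *)
Lemma horner_expR_bound (p : {poly R}) : exists C, forall t, 0 < t <= 1 ->
  `|p.[t^-1] * expR (- t^-1)| <= C * t ^+ 2.
Proof.
exists ((\sum_(i < size p) `|p`_i|) * (size p).+2`!%:R) => t /andP[t0 t1].
have u1 : 1 <= t^-1 by rewrite invf_ge1.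
have u0 : 0 < t^-1 by rewrite invr_gt0.
rewrite normrM (ger0_norm (expR_ge0 _)).
have pu : `|p.[t^-1]| <= (\sum_(i < size p) `|p`_i|) * t^-1 ^+ (size p).
  rewrite horner_coef mulr_suml (le_trans (ler_norm_sum _ _ _))//.
  apply: ler_sum => i _; rewrite normrM ler_wpM2l// normrX gtr0_norm//.
  by rewrite ler_weXn2l// ltnW.
have e1 : expR (- t^-1) <= (size p).+2`!%:R * t ^+ (size p).+2.
  rewrite expRN -[t in leRHS]invrK exprVn -[X in X * _]invrK -invfM lef_pV2 ?posrE.
  - have := expR_ge1Dxn (size p).+1 (ltW u0).
    by apply: le_trans; rewrite mulrC lerDr.
  - exact: expR_gt0.
  - by rewrite mulr_gt0 ?invr_gt0 ?exprn_gt0// ltr0n fact_gt0.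
apply: (@le_trans _ _ (((\sum_(i < size p) `|p`_i|) * t^-1 ^+ (size p)) *
   ((size p).+2`!%:R * t ^+ (size p).+2))).
  by apply: ler_pM => //; exact: expR_ge0.
rewrite -!mulrA ler_wpM2l ?sumr_ge0// mulrCA ler_wpM2l//.
by rewrite -addn2 exprD exprVn mulKf// gt_eqF// exprn_gt0.
Qed.

Lemma tower_expinv : tower expinv.
Proof.
move=> k x; have [x0|x0|->] := ltgtP x 0.
- apply: (@near_eq_is_derive _ _ _ (cst 0)).
  + near=> y; rewrite /expinv ifF//; apply/negbTE; rewrite -leNgt ltW//.
    by near: y; exact: lt_nbhsl.
  + by apply: is_derive_eq; rewrite /expinv ltNge (ltW x0).
- have xV : is_derive x 1 (fun t : R => t^-1) (- x ^- 2).
    have xn0 : (id x : R) != 0 by rewrite gt_eqF.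
    by apply: is_derive_eq (is_deriveV xn0 (is_derive_id x 1)) _; rewrite -[LHS]/(_ * _) mulr1.
  apply: (@near_eq_is_derive R R R (fun t : R => (expinv_poly k).[t^-1] * expR (- t^-1))).
    near=> y; rewrite /expinv ifT//.
    by near: y; exact: lt_nbhsr.
  have pV : is_derive x 1 (fun t => (expinv_poly k).[t^-1])
      ((expinv_poly k)^`().[x^-1] * (- x ^- 2)).
    exact: (is_derive1_comp (f := horner (expinv_poly k))).
  have NV : is_derive x 1 (fun t : R => - t^-1) (x ^- 2).
    by have := is_deriveN xV; rewrite opprK.
  have eV : is_derive x 1 (fun t => expR (- t^-1)) (expR (- x^-1) * (x ^- 2)).
    exact: (is_derive1_comp (f := expR) (g := fun t : R => - t^-1)).
  have pe := is_deriveM pV eV.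
  apply: is_derive_eq pe _; rewrite /expinv x0 /=.
  rewrite hornerM hornerXn hornerD hornerN -!exprVn.
  by rewrite -[LHS]/(_ * _ + _ * _); ring.
(* At 0 the difference quotient vanishes for h < 0 and is at most C h for 0 < h <= 1. *)
- have [C HC] := horner_expR_bound (expinv_poly k).
  have C0 : 0 <= C.
    by have := le_trans (normr_ge0 _) (HC 1 _); rewrite expr1n mulr1; apply; rewrite ltr01 lexx.
  rewrite {2}/expinv ltxx; apply: is_derive_cvg.
  rewrite /expinv ltxx; apply/cvgr0Pnorm_le => e e0.
  near=> h.
  rewrite addr0 subr0 -[h *: 1]/(h * 1) mulr1; case: ifPn => [h0|]; last first.
    by rewrite scaler0 normr0 ltW.
  have h1 : 0 < h <= 1.
    rewrite h0 /= -(gtr0_norm h0); near: h; exact: dnbhs0_le.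
  rewrite -[_ *: _]/(_ * _) normrM.
  apply: (le_trans (ler_wpM2l (normr_ge0 _) (HC _ h1))).
  rewrite normfV gtr0_norm// mulrCA expr2 mulKf ?gt_eqF//.
  apply: (@le_trans _ _ ((C + 1) * h)); first by rewrite ler_wpM2r ?lerDl// ltW.
  rewrite -ler_pdivlMl ?ltr_pwDr// -(gtr0_norm h0); near: h; apply: dnbhs0_le.
  by rewrite mulr_gt0// invr_gt0 ltr_pwDr.
Unshelve. all: by end_near. Qed.

(** The successive derivatives of the standard bump exp(-1/t) exp(-1/(1-t)), extended by zero
    outside (0, 1). *)
Definition bump : nat -> R -> R := fun k =>
  leibniz expinv (fun k t => (-1) ^+ k * expinv k (-1 * t + 1)) k 0 0.

Lemma tower_bump : tower bump.
Proof. by apply: tower_leibniz; [exact: tower_expinv|exact/tower_affine/tower_expinv]. Qed.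

Lemma bumpE t : bump 0 t = if 0 < t < 1 then expR (- t^-1) * expR (- (1 - t)^-1) else 0.
Proof.
rewrite /bump /= -[LHS]/(expinv 0 t * ((-1) ^+ 0 * expinv 0 (-1 * t + 1))).
have e0 u : expinv 0 u = if 0 < u then expR (- u^-1) else 0.
  by rewrite /expinv /=; case: ifP => //; rewrite hornerE mul1r.
rewrite !e0 expr0 mul1r mulN1r (addrC (- t)) subr_gt0.
by case: ifP => _ /=; rewrite ?mul0r//; case: ifP => _; rewrite ?mulr0.
Qed.

Lemma bump_ge0 t : 0 <= bump 0 t.
Proof. by rewrite bumpE; case: ifP => // _; rewrite mulr_ge0// expR_ge0. Qed.

Lemma continuous_tower D : tower D -> forall k, continuous (D k).
Proof.
move=> tD k x; apply: differentiable_continuous; apply/derivable1_diffP.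
by have [] := tD k x.
Qed.

Lemma bump_antiderivative : exists P : R -> R,
  forall x : R, is_derive x 1 P (bump 0 x).
Proof.
have cb : continuous (bump 0) by exact/continuous_tower/tower_bump.
have ib : (@lebesgue_measure R).-integrable setT (EFin \o bump 0).
  have -> : bump 0 = bump 0 \_ `[0, 1].
    apply/funext => t; rewrite patchE; case: ifPn => //.
    rewrite notin_setE/= in_itv/= bumpE => /negP; case: ifP => // /andP[t0 t1].
    by rewrite (ltW t0) (ltW t1).
  rewrite -restrict_EFin -integrable_mkcond//.
  apply: continuous_compact_integrable; first exact: segment_compact.
  exact: continuous_subspaceT.
exists (fun x => \int[@lebesgue_measure R]_(t in `]-oo, x]) bump 0 t) => x.
have [||dF F'] := @continuous_FTC1 R (bump 0) -oo%O x (x + 1) _ _ (ltNyr _) (cb x).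
  by rewrite ltrDl.
  exact: integrableS ib.
by apply: DeriveDef => //; rewrite -derive1E.
Qed.

Lemma step_tower : exists D, [/\ tower D, {homo D 0%N : x y / x <= y},
  forall t, t <= 0 -> D 0%N t = 0 & forall t, 1 <= t -> D 0%N t = 1].
Proof.
have [P dP] := bump_antiderivative.
have cP : continuous P.
  by move=> x; apply: differentiable_continuous; apply/derivable1_diffP; have [] := dP x.
have mvt a b : a < b -> exists2 c, c \in `]a, b[ & P b - P a = bump 0 c * (b - a).
  move=> ab; have [|c ? ?] := MVT ab (fun x _ => dP x); last by exists c.
  exact: continuous_subspaceT.
have Pcst a b : a < b -> (forall t, t \in `]a, b[ -> bump 0 t = 0) -> P b = P a.
  move=> ab b0; have [c cab] := mvt _ _ ab.
  by rewrite b0// mul0r => /eqP; rewrite subr_eq0 => /eqP.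
have P01 : 0 < P 1 - P 0.
  have [c] := mvt _ _ ltr01.
  rewrite in_itv/= => c01 ->.
  by rewrite subr0 mulr1 bumpE c01 mulr_gt0// expR_gt0.
(* The antiderivative of the bump, normalized to take the values 0 at 0 and 1 at 1. By the mean
   value theorem it is monotone, and constant on both sides of [0, 1]. *)
exists (fun k => if k is k'.+1 then fun t => (P 1 - P 0)^-1 * bump k' t
                 else fun t => (P 1 - P 0)^-1 * (P t - P 0)); split => [[|k] x|x y|t|t] /=.
- have ? := dP x.
  have -> : (fun t => (P 1 - P 0)^-1 * (P t - P 0)) = (P 1 - P 0)^-1 *: (P - cst (P 0)) by [].
  by apply: is_derive_eq; rewrite subr0.
- by have ? := tower_bump k x; exact: is_deriveZ.
- rewrite le_eqVlt => /predU1P[->//|xy]; rewrite ler_wpM2l ?invr_ge0 ?(ltW P01)// lerB//.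
  have [c _] := mvt _ _ xy; rewrite -subr_ge0 => ->.
  by rewrite mulr_ge0 ?bump_ge0// subr_ge0 ltW.
- rewrite le_eqVlt => /predU1P[->|t0]; first by rewrite subrr mulr0.
  rewrite -(Pcst _ _ t0) ?subrr ?mulr0// => c; rewrite in_itv/= => /andP[_ c0].
  by rewrite bumpE ltNge (ltW c0).
- rewrite le_eqVlt => /predU1P[<-|t0]; first by rewrite mulVf// gt_eqF.
  rewrite (Pcst _ _ t0) ?mulVf ?gt_eqF// => c; rewrite in_itv/= => /andP[c0 _].
  by rewrite bumpE (ltNge _ 1) (ltW c0) andbF.
Qed.

(* For a smooth step S, the integer translates of S (t + 1) - S t form a
   partition of unity, because their sums telescope. *)
Lemma hat_tower : exists D, [/\ tower D, forall t, 0 <= D 0%N t,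
  forall t, D 0%N t != 0 -> `|t| < 1,
  forall t N, \sum_(j < N) D 0%N (t - j%:R) <= 1 &
  forall t N, 0 <= t <= N%:R -> \sum_(j < N.+1) D 0%N (t - j%:R) = 1].
Proof.
have [S [tS hS S0 S1]] := step_tower.
have S01 t : 0 <= S 0%N t <= 1.
  have [t0|t0] := leP t 0; first by rewrite S0// lexx ler01.
  have [t1|t1] := leP 1 t; first by rewrite S1// lexx ler01.
  by rewrite -[X in X <= _ <= _](S0 0)// -[X in _ <= _ <= X](S1 1)// !hS ?ltW.
have sumE t N : \sum_(j < N) (S 0%N (t - j%:R + 1) - S 0%N (t - j%:R)) =
    S 0%N (t + 1) - S 0%N (t + 1 - N%:R).
  elim: N => [|N IH]; first by rewrite big_ord0 subr0 subrr.
  rewrite big_ord_recr/= IH -addrA; congr (_ + _).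
  rewrite [t - _ + 1]addrAC addKr; congr (- S 0%N _).
  by rewrite -natr1; ring.
exists (fun k t => S k (t + 1) - S k t); split.
- have -> : (fun k t => S k (t + 1) - S k t) =
      (fun k => (fun t => 1 ^+ k * S k (1 * t + 1)) - S k).
    by apply/funext => k; apply/funext => t;
      rewrite -[RHS]/(1 ^+ k * S k (1 * t + 1) - S k t) expr1n !mul1r.
  exact: (towerB (tower_affine 1 1 tS) tS).
- by move=> t; rewrite subr_ge0 hS// lerDl.
- move=> t; apply: contra_neqT; rewrite -leNgt ler_normr => /orP[t1|t1].
    by rewrite !S1 ?subrr// (le_trans t1)// lerDl.
  by rewrite !S0 ?subrr//; lra.
- move=> t N; rewrite sumE lerBlDr (le_trans (andP (S01 _)).2)//.
  by rewrite lerDl (andP (S01 _)).1.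
- move=> t N /andP[t0 tN]; rewrite sumE S1 ?lerDr// S0 ?subr0//.
  by rewrite -natr1; lra.
Qed.

End derivative_towers.

(** * Density of smooth fields among continuous ones *)

Section row_norm.
Context {R : realType} {n : nat}.
Implicit Types x : 'rV[R]_n.

Lemma coord_le_norm x i : `|x 0 i| <= `|x|.
Proof.
by rewrite [leRHS]/Num.norm /= mx_normrE; apply/bigmax_geP; right => /=; exists (0, i).
Qed.

Lemma norm_lt_coord x (c : R) : 0 < c -> (forall i, `|x 0 i| < c) -> `|x| < c.
Proof.
move=> c0 xc; rewrite [ltLHS]/Num.norm /= mx_normrE; apply/bigmax_ltP; split => //=.
by move=> [i j] _ /=; rewrite (ord1 i).
Qed.

End row_norm.

Section separated_variables.
Context {R : realType} {n : nat} {Z : finType}.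
Local Notation Rn := 'rV[R]_n.
Variables (D : Z -> 'I_n -> nat -> R -> R) (c : Z -> Rn).
Hypothesis tD : forall z i, tower (D z i).

(** A class of fields stable under partial derivatives: [m i] counts the derivatives taken in the
    variable i, so that [partial j] only increments [m j]. *)
Definition sepvar (m : 'I_n -> nat) (x : Rn) : Rn :=
  \sum_(z : Z) (\prod_(i < n) D z i (m i) (x 0 i)) *: c z.

Definition incr_at (j : 'I_n) (m : 'I_n -> nat) i := ((i == j) + m i)%N.

Lemma is_derive_sepvar m j x :
  is_derive x (delta_mx 0 j) (sepvar m) (sepvar (incr_at j m) x).
Proof.
apply: is_derive1P; rewrite /sepvar; apply: is_derive_bigsum => z.
(* Along the j-th axis only the j-th factor of the product varies. *)
rewrite (_ : (fun h => _) = fun h => D z j (m j) (1 * h + x 0 j) *: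
   ((\prod_(i < n | i != j) D z i (m i) (x 0 i)) *: c z)); last first.
  apply/funext => h; rewrite (bigD1 j)//= scalerA !mxE !eqxx mulr1 mul1r.
  congr ((_ * _) *: _); apply: eq_bigr => i ij.
  by rewrite !mxE (negbTE ij) andbF mulr0 add0r.
have -> : \prod_(i < n) D z i (incr_at j m i) (x 0 i) *: c z =
    D z j (m j).+1 (x 0 j) *: ((\prod_(i < n | i != j) D z i (m i) (x 0 i)) *: c z).
  rewrite (bigD1 j)//= {1}/incr_at eqxx add1n -scalerA; congr (_ *: (_ *: _)).
  by apply: eq_bigr => i ij; rewrite /incr_at (negbTE ij).
apply: is_derive_scalel.
have Dj : is_derive (1 * 0 + x 0 j) 1 (D z j (m j)) (D z j (m j).+1 (x 0 j)).
  by rewrite mulr0 add0r; exact: tD.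
by have := is_derive1_comp_affine Dj; rewrite mul1r.
Qed.

Lemma continuous_sepvar m : continuous (sepvar m).
Proof.
apply: continuous_big => [|z _].
- exact: add_continuous.
- have cD i : continuous (fun x : Rn => D z i (m i) (x 0 i)).
    move=> x; apply: (@continuous_comp _ _ _ (fun x : Rn => x 0 i) (D z i (m i))).
      exact: coord_continuous.
    exact: continuous_tower.
  move=> x; apply: (@continuousZr_tmp R Rn Rn (fun x => \prod_(i < n) D z i (m i) (x 0 i))).
  apply: (@continuous_big R _ *%R 1 xpredT (@mul_continuous R) Rn) => i _.
  exact: cD.
Qed.

Lemma iter_partial_sepvar s m :
  iter_partial s (sepvar m) = sepvar (foldr incr_at m s).
Proof.
elim: s => [//|j s IH] /=; rewrite IH; apply/funext => x.
by rewrite /partial; have [_ ->] := is_derive_sepvar (foldr incr_at m s) j x.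
Qed.

Lemma smooth_sepvar m : smooth (sepvar m).
Proof.
move=> s; rewrite iter_partial_sepvar; split; first exact: continuous_sepvar.
by move=> j x; have [] := is_derive_sepvar (foldr incr_at m s) j x.
Qed.

End separated_variables.

Section approximation.
Context {R : realType} {n : nat}.
Local Notation Rn := 'rV[R]_n.
Implicit Types (K U : set Rn) (phi psi : Rn -> Rn).

(** A Lebesgue number argument: compactness turns radii depending on the point into a single one. It
    yields both uniform continuity and the margin between a compact set and an open
    neighbourhood. *)
Lemma compact_uniform K (Q : Rn -> Rn -> Prop) : compact K ->
  (forall x, K x -> exists2 e : R, 0 < e &
     forall y z, `|x - y| < e -> `|x - z| < e -> Q y z) ->
  exists2 d : R, 0 < d & forall y z, K y -> `|y - z| < d -> Q y z.
Proof.
move=> cK KQ.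
have near_K := (compact_near_coveringP K).1 cK _ (0^'+ : set_system R)
  (fun d y => forall z, `|y - z| < d -> Q y z) _.
have [x Kx|] := near_K _.
  have [e e0 He] := KQ x Kx.
  exists ([set y | `|x - y| < e / 2], [set d | d < e / 2]).
    split; last by apply: nbhs_right_lt; rewrite divr_gt0.
    have /cvgrPdist_lt/(_ (e / 2)) : id y @[y --> x] --> (x : Rn) by exact: cvg_id.
    by apply; rewrite divr_gt0.
  move=> [y d] /= [xy de] z yz; apply: He.
    by rewrite (lt_le_trans xy)// ler_pdivrMr// ler_peMr// ?ler1n// ltW.
  rewrite -(subrK y x) -addrA (le_lt_trans (ler_normD _ _))// (splitr e) ltrD//.
  exact: lt_trans de.
move=> e /= e0 He; exists (e / 2); first by rewrite divr_gt0.
move=> y z Ky yz; apply: (He (e / 2)) => //=; last by rewrite divr_gt0.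
by rewrite sub0r normrN gtr0_norm ?divr_gt0// ltr_pdivrMr// ltr_pMr// ltr1n.
Qed.

Lemma tsupportPn phi x : ~ tsupport phi x -> phi x = 0.
Proof.
by move=> sx; apply: contra_notP sx => /eqP phix; exact: subset_closure.
Qed.

Lemma Cc_unif_continuous U phi (e : R) : Cc U phi -> 0 < e ->
  exists2 d : R, 0 < d & forall x y, `|x - y| < d -> `|phi x - phi y| < e.
Proof.
move=> [cphi ck _] e0.
have [x _|d d0 Hd] := compact_uniform (Q := fun x y => `|phi x - phi y| < e) ck.
  have /cvgrPdist_lt/(_ (e / 2)) := cphi x.
  move=> /(_ (divr_gt0 e0 (ltr0Sn _ _))) /nbhs_normP[d /= d0 Hd].
  exists d => // y z /Hd xy /Hd xz.
  rewrite -(subrK (phi x) (phi y)) -addrA (le_lt_trans (ler_normD _ _))// (splitr e) ltrD//.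
  by rewrite distrC.
exists d => // x y xy.
(* If only y lies in the support, x and y are exchanged; if neither does, both values are 0. *)
have [kx|/tsupportPn x0] := pselect (tsupport phi x); first exact: Hd.
have [ky|/tsupportPn y0] := pselect (tsupport phi y); last by rewrite x0 y0 subrr normr0.
by rewrite distrC Hd// distrC.
Qed.

Lemma compact_open_margin K U : compact K -> open U -> K `<=` U ->
  exists2 d : R, 0 < d & forall x y, K x -> `|x - y| < d -> U y.
Proof.
move=> cK oU KU; apply: (compact_uniform (Q := fun _ => U)) => // x /KU Ux.
have /nbhs_normP[d /= d0 Hd] : nbhs x U by exact: open_nbhs_nbhs.
by exists d => // y z _ /Hd.
Qed.

Lemma compact_norm_bounded K : compact K -> exists B : R, forall x, K x -> `|x| <= B.
Proof.
by move=> /compact_bounded[M [_ /(_ (M + 1))]]; rewrite ltrDl => /(_ ltr01) ?; exists (M + 1).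
Qed.

Lemma Cc_infty_dense U phi (e : R) : open U -> Cc U phi -> 0 < e ->
  exists2 psi, Cc_infty U psi & forall x, `|psi x - phi x| <= e.
Proof.
move=> oU Uphi e0; have [cphi ck kU] := Uphi.
have [d0 d0_gt0 Hd0] := Cc_unif_continuous Uphi e0.
have [d1 d1_gt0 Hd1] := compact_open_margin ck oU kU.
have [B HB] := compact_norm_bounded ck.
(* The mesh d is at most d0, so that phi varies by less than e within a cell, and at most d1 / 2, so
   that moving twice by d from the support of phi stays in U. *)
pose d := Num.min d0 (d1 / 2).
have d_gt0 : 0 < d by rewrite lt_min d0_gt0 divr_gt0.
have d_n0 : d != 0 by rewrite gt_eqF.
(* The grid of nodes d (z - N), with coordinates of z from 0 to 2N, then covers the support of phi,
   contained in the ball of radius B. *)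
pose N := Num.bound (B / d).
have [h [th h0 hn0 hle1 hsum1]] := @hat_tower R.
pose Z := {ffun 'I_n -> 'I_(2 * N).+1}.
pose p (z : Z) : Rn := \row_i (d * ((z i)%:R - N%:R)).
pose D (z : Z) i k (t : R) := d^-1 ^+ k * h k (d^-1 * t + (N%:R - (z i)%:R)).
have tD z i : tower (D z i) by exact: tower_affine.
pose w (z : Z) (x : Rn) := \prod_(i < n) D z i 0 (x 0 i).
pose psi := sepvar D (phi \o p) (fun=> 0%N).
have psiE x : psi x = \sum_z w z x *: phi (p z) by [].
have w0 z x : 0 <= w z x by apply: prodr_ge0 => i _; rewrite /D expr0 mul1r.
have wN0 z x : w z x != 0 -> `|x - p z| < d.
  move=> /prodf_neq0 wz; apply: norm_lt_coord => // i.
  have /hn0 : h 0%N (d^-1 * x 0 i + (N%:R - (z i)%:R)) != 0.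
    by have := wz i isT; rewrite /D expr0 mul1r.
  rewrite !mxE => hx.
  have -> : x 0 i - d * ((z i)%:R - N%:R) = d * (d^-1 * x 0 i + (N%:R - (z i)%:R)).
    by field.
  by rewrite normrM gtr0_norm// gtr_pMr.
(* The weights are products over the coordinates, so their sum factors into sums of hats in one
   variable. *)
have sumw x : \sum_z w z x =
    \prod_(i < n) \sum_(j < (2 * N).+1) h 0%N (d^-1 * x 0 i + N%:R - j%:R).
  rewrite bigA_distr_bigA; apply: eq_bigr => z _; apply: eq_bigr => i _.
  by rewrite /D expr0 mul1r addrA.
have sumw_le1 x : \sum_z w z x <= 1.
  rewrite sumw; apply: prodr_ile1 => i _.
  by rewrite hle1 andbT sumr_ge0.
have sumw1 x : phi x != 0 -> \sum_z w z x = 1.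
  move=> phix; rewrite sumw big1// => i _; apply: hsum1.
  have kx : tsupport phi x by apply: contrapT => /tsupportPn/eqP; exact/negP.
  have xB : `|x 0 i| <= B := le_trans (coord_le_norm x i) (HB _ kx).
  have BN : B / d < N%:R by apply: archi_boundP; rewrite divr_ge0 ?(ltW d_gt0)// (le_trans _ xB).
  have : `|d^-1 * x 0 i| < N%:R.
    by rewrite normrM gtr0_norm ?invr_gt0// mulrC (le_lt_trans _ BN)// ler_pM2r ?invr_gt0.
  by rewrite ltr_norml natrM => /andP[? ?]; lra.
(* Near y some x has psi x nonzero, and x is within d of a node where phi is nonzero. *)
have supp_psi y : tsupport psi y -> exists2 x, tsupport phi x & `|x - y| < d1.
  move=> /(_ [set x | `|y - x| < d])[|x [/= psix yx]].
    have /cvgrPdist_lt/(_ d) : id x @[x --> y] --> (y : Rn) by exact: cvg_id.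
    exact.
  have [z wz pz] : exists2 z, w z x != 0 & phi (p z) != 0.
    apply: contrapT => H; move/eqP : psix; apply; rewrite psiE big1// => z _.
    have [->|wz] := eqVneq (w z x) 0; first by rewrite scale0r.
    have [->|pz] := eqVneq (phi (p z)) 0; first by rewrite scaler0.
    by exfalso; apply: H; exists z.
  exists (p z); first exact: subset_closure.
  rewrite distrC -(subrK x y) -addrA (le_lt_trans (ler_normD _ _))//.
  rewrite (splitr d1) ltrD//; last apply: (lt_le_trans (wN0 _ _ wz)).
    by rewrite (lt_le_trans yx)// ge_min lexx orbT.
  by rewrite ge_min lexx orbT.
exists psi.
  split; first exact: smooth_sepvar.
    apply: bounded_closed_compact; last exact: closed_closure.
    exists (B + d1); split; first exact: num_real.
    move=> M BM y /supp_psi[x kx xy]; rewrite /= (le_trans _ (ltW BM))//.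
    rewrite -(subrK x y) addrC (le_trans (ler_normD _ _))// lerD ?HB//.
    by rewrite distrC ltW.
  by move=> y /supp_psi[x kx xy]; exact: Hd1 xy.
move=> x.
(* Where phi x is nonzero the weights sum to 1; where it is 0 the subtracted terms vanish, whatever
   the sum of the weights. *)
have -> : psi x - phi x = \sum_z w z x *: (phi (p z) - phi x).
  under [RHS]eq_bigr do rewrite scalerBr.
  rewrite sumrB -scaler_suml psiE; congr (_ - _).
  by have [->|/sumw1 ->] := eqVneq (phi x) 0; rewrite ?scaler0 ?scale1r.
rewrite (le_trans (ler_norm_sum _ _ _))// (@le_trans _ _ (\sum_z w z x * e))//.
  apply: ler_sum => z _; rewrite normrZ (ger0_norm (w0 _ _)).
  have [->|/wN0 xz] := eqVneq (w z x) 0; first by rewrite !mul0r.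
  rewrite ler_wpM2l// ltW// distrC Hd0// (lt_le_trans xz)// ge_min lexx//.
by rewrite -mulr_suml ler_piMl// ltW.
Qed.

End approximation.

(** * Integrals and convergence of sets in L^1_loc *)

(* The integrands below need not be measurable: sets in the completed
   sigma-algebra are replaced by Borel sets under the integral sign by working
   on the supremum over simple functions that defines the library integral. *)
Section integral_modulo_null.
Local Open Scope ereal_scope.
Context d (T : measurableType d) (R : realType) (mu : {measure set T -> \bar R}).
Implicit Types (f g : T -> \bar R) (M : set T).
Import HBNNSimple.

Lemma ge0_le_integral_modulo_null f g M : measurable M -> mu M = 0 ->
  (forall x, 0 <= f x) -> (forall x, 0 <= g x) ->
  (forall x, ~ M x -> f x <= g x) -> \int[mu]_x f x <= \int[mu]_x g x.
Proof.
move=> mM M0 f0 g0 fg; rewrite !ge0_integralTE//.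
apply/ge_ereal_sup => _ /= [h hf <-]; apply: ereal_sup_ubound => /=.
have mMC : measurable (~` M) by exact: measurableC.
(* Setting a simple function h below f to zero on M puts it below g and keeps its integral. *)
exists (proj_nnsfun h mMC).
  move=> x /=; rewrite mindicE; case: (pselect (M x)) => Mx.
    by rewrite memNset ?mulr0//; exact.
  by rewrite mem_set// mulr1 (le_trans (hf x))// fg.
transitivity (\int[mu]_(x in ~` M) (h x)%:E).
  by rewrite integral_nnsfun//; congr sintegral; rewrite mrestrict.
transitivity (\int[mu]_x (h x)%:E); last by rewrite integral_nnsfun// patch_setT.
rewrite -[in LHS]setTD -ge0_negligible_integral//.
  by apply/measurable_EFinP; exact: measurable_funPT.
by move=> x _; rewrite lee_fin.
Qed.

Lemma integral_modulo_null f g M : measurable M -> mu M = 0 ->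
  (forall x, ~ M x -> f x = g x) -> \int[mu]_x f x = \int[mu]_x g x.
Proof.
move=> mM M0 fg; rewrite integralE [RHS]integralE.
by congr (_ - _); apply/eqP; rewrite eq_le; apply/andP; split;
  apply: (ge0_le_integral_modulo_null mM M0) => // x /fg e;
  rewrite ?(funepos_ge0, funeneg_ge0) // ?(funeposE, funenegE) e.
Qed.

Lemma completed_set_modulo_null (E : set T) : completed_algebra_gen mu E ->
  exists A M, [/\ measurable A, measurable M, mu M = 0 &
    forall x, ~ M x -> E x <-> A x].
Proof.
move=> [A mA [N [M [mM M0 NM]] <-]]; exists A, M; split => // x Mx.
by split => [[//|/NM]|]; [|left].
Qed.

Lemma integral_completed (E A M : set T) f : measurable M -> mu M = 0 ->
  (forall x, ~ M x -> E x <-> A x) ->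
  \int[mu]_(x in E) f x = \int[mu]_(x in A) f x.
Proof.
move=> mM M0 EA; rewrite integral_mkcond [RHS]integral_mkcond.
apply: (integral_modulo_null mM M0) => x /EA xEA; rewrite !patchE.
by congr (if _ then _ else _); apply/idP/idP; rewrite !inE => /xEA.
Qed.

End integral_modulo_null.

Section integral_cvg_L1loc.
Context {R : realType} {n : nat}.
Local Notation Rn := 'rV[R]_n.
Local Notation leb := (@lebesgue_rV R n).

Lemma closed_norm_le (c : R) : closed [set x : Rn | `|x| <= c].
Proof.
apply: (@preimage_closed _ _ (fun x : Rn => `|x|) [set r | r <= c]).
  by move=> x _; exact: norm_continuous.
exact: closed_le.
Qed.

Lemma measurable_norm_le (c : R) : measurable [set x : Rn | `|x| <= c].
Proof.
rewrite -[X in measurable X]setCK; apply: measurableC; apply: open_measurable_rV.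
by rewrite openC; exact: closed_norm_le.
Qed.

Lemma compact_norm_le (c : R) : compact [set x : Rn | `|x| <= c].
Proof.
apply: bounded_closed_compact; last exact: closed_norm_le.
exists c; split; first exact: num_real.
by move=> M cM x /= xc; rewrite (le_trans xc)// ltW.
Qed.

(** Dominated convergence: each x lies in all large balls, and |F| dominates. *)
Lemma integral_tail_cvg0 (F : Rn -> R) : leb.-integrable setT (EFin \o F) ->
  (\int[leb]_(x in ~` [set x : Rn | (`|x| <= m%:R)%R]) (`|F x|)%:E)%E @[m --> \oo] --> 0%E.
Proof.
move=> iF.
pose B m := [set x : Rn | `|x| <= m%:R].
have mB m : measurable (B m) by exact: measurable_norm_le.
have iaF := integrable_norm iF.
under eq_fun => m do rewrite integral_mkcond.
have maF : measurable_fun setT (fun x => (`|F x|)%:E) by exact: measurable_int iaF.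
pose G m := (fun x => (`|F x|)%:E) \_ (~` B m).
have mG m : measurable_fun setT (G m).
  apply/(measurable_restrictT _ _).1; first exact: measurableC.
  exact: measurable_funTS.
have G0 : {ae leb, forall x, setT x -> G ^~ x @ \oo --> (cst 0%E : Rn -> \bar R) x}.
  apply: aeW => x _; apply: cvg_near_cst; near=> m.
  rewrite /G patchE memNset// /B /=; apply.
  by near: m; exact: nbhs_infty_ger.
have GF : {ae leb, forall x m, setT x -> (`|G m x| <= (`|F x|)%:E)%E}.
  apply: aeW => x m _; rewrite /G patchE; case: ifP => _; last by rewrite abse0 lee_fin.
  by rewrite gee0_abs ?lee_fin.
have [_ _] := dominated_convergence measurableT mG (measurable_cst _) G0 iaF GF.
by rewrite integral0.
Unshelve. all: by end_near. Qed.

Lemma cvg_Rintegral_L1loc (F : Rn -> R) (C : R) (E_ : nat -> set Rn) (E : set Rn) :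
  leb.-integrable setT (EFin \o F) -> (forall x, `|F x| <= C) ->
  (forall k, lebesgue_measurable (E_ k)) -> lebesgue_measurable E ->
  cvg_L1loc (fun k => \1_(E_ k)) (\1_E) ->
  (\int[leb]_(x in E_ k) F x) @[k --> \oo] --> \int[leb]_(x in E) F x.
Proof.
move=> iF FC mE_ mE EE.
have C0 : 0 <= C := le_trans (normr_ge0 _) (FC 0).
(* E and the E_k are replaced by Borel sets A and A_k that agree with them off null sets; neither
   the integrals nor the local convergence change. *)
have [A [M [mA mM M0 EA]]] := completed_set_modulo_null mE.
have [A_ /all_sig[M_ H_]] : {A_ : nat -> set Rn & forall k, {M | [/\ measurable (A_ k),
    measurable M, leb M = 0%E & forall x, ~ M x -> E_ k x <-> A_ k x]}}.
  have AM k : {AM | [/\ measurable AM.1, measurable AM.2, leb AM.2 = 0%E &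
      forall x, ~ AM.2 x -> E_ k x <-> AM.1 x]}.
    by apply: cid; have [B [N BN]] := completed_set_modulo_null (mE_ k); exists (B, N).
  by exists (fun k => (sval (AM k)).1) => k; exists (sval (AM k)).2; exact: svalP (AM k).
have mA_ k : measurable (A_ k) by have [] := H_ k.
have RE : \int[leb]_(x in E) F x = \int[leb]_(x in A) F x.
  by rewrite /Rintegral (integral_completed _ mM M0 EA).
have RE_ k : \int[leb]_(x in E_ k) F x = \int[leb]_(x in A_ k) F x.
  by have [_ mMk Mk0 EAk] := H_ k; rewrite /Rintegral (integral_completed _ mMk Mk0 EAk).
rewrite RE; under eq_fun do rewrite RE_.
pose dist k (x : Rn) : R := `|\1_(A_ k) x - \1_A x|.
have mdist k : measurable_fun setT (dist k).
  by apply: measurableT_comp => //; apply: measurable_funB; exact: measurable_indic.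
have AA (K : set Rn) : compact K ->
    (\int[leb]_(x in K) (dist k x)%:E)%E @[k --> \oo] --> 0%E.
  move=> cK; rewrite (_ : (fun k => _) =
    (fun k => \int[leb]_(x in K) `|\1_(E_ k) x - \1_E x|%:E)%E); first exact: EE.
  apply/funext => k.
  have [_ mMk Mk0 EAk] := H_ k.
  rewrite integral_mkcond [RHS]integral_mkcond.
  apply: (@integral_modulo_null _ _ R leb _ _ (M `|` M_ k)).
  - exact: measurableU.
  - by rewrite null_set_setU.
  - move=> x /not_orP[/EA EAx /EAk EAkx]; rewrite !patchE /dist !indicE.
    have -> : (x \in E) = (x \in A) by apply/idP/idP; rewrite !inE => /EAx.
    by have -> : (x \in E_ k) = (x \in A_ k) by apply/idP/idP; rewrite !inE => /EAkx.
pose B m := [set x : Rn | `|x| <= m%:R].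
have mB m : measurable (B m) by exact: measurable_norm_le.
have iFA D : measurable D -> leb.-integrable setT (EFin \o F \_ D).
  by move=> mD; rewrite -restrict_EFin -integrable_mkcond//; exact: integrableS iF.
have mF : measurable_fun setT F by apply/measurable_EFinP; exact: measurable_int iF.
(* The difference is the integral of F times a difference of indicators. On the ball, |F| is bounded
   by C; off the ball, the difference of indicators is bounded by 1. *)
have key k m : ((`|\int[leb]_(x in A_ k) F x - \int[leb]_(x in A) F x|)%:E <=
    C%:E * \int[leb]_(x in B m) (dist k x)%:E + \int[leb]_(x in ~` B m) (`|F x|)%:E)%E.
  have FdE x : (F \_ (A_ k)) x - (F \_ A) x = F x * (\1_(A_ k) x - \1_A x).
    by rewrite !patchE !indicE; do 2 case: ifP => _;
      rewrite ?subr0 ?sub0r ?subrr ?mulr1 ?mulr0 ?mulrN1.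
  have mFd : measurable_fun setT (fun x => F x * (\1_(A_ k) x - \1_A x)).
    by apply: measurable_funM => //; apply: measurable_funB; exact: measurable_indic.
  have mnFd : measurable_fun setT (fun x => `|F x * (\1_(A_ k) x - \1_A x)|%:E).
    by apply/measurable_EFinP; exact: measurableT_comp.
  rewrite (Rintegral_mkcond _ (A_ k)) (Rintegral_mkcond _ A) -RintegralB//; [|exact: iFA..].
  under eq_Rintegral do rewrite FdE.
  rewrite EFin_normr_Rintegral//; last first.
    apply: eq_integrable (integrableB measurableT (iFA _ (mA_ k)) (iFA _ mA)) => // x _.
    by rewrite /= -FdE.
  apply: (le_trans (le_abse_integral _ _ _)) => //.
    exact/measurable_EFinP.
  rewrite -(setUv (B m)) ge0_integral_setU//; last 3 first.
  - exact: measurableC.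
  - by rewrite setUv.
  - by rewrite disj_set2E setICr.
  rewrite leeD//.
    rewrite -ge0_integralZl//.
    apply: ge0_le_integral => //.
    - exact: measurable_funTS.
    - by apply/measurable_EFinP; apply: measurable_funM => //; exact: measurable_funTS.
    - by move=> x _; rewrite lee_fin normrM ler_wpM2r.
    - by apply/measurable_EFinP; exact: measurable_funTS.
    - by move=> x _; rewrite lee_fin /dist.
  apply: ge0_le_integral => //.
  - exact: measurableC.
  - exact: measurable_funTS.
  - by apply/measurable_EFinP; apply: measurable_funTS; exact: measurableT_comp.
  - move=> x _; rewrite lee_fin normrM ler_piMr// !indicE.
    by do 2 case: (_ \in _); rewrite ?subrr ?subr0 ?sub0r ?normrN ?normr1 ?normr0.
apply/cvgrPdist_le => e e0.
have e2 : (0 < (e / 2)%:E)%E by rewrite lte_fin divr_gt0.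
have [m mtail] : exists m, (\int[leb]_(x in ~` B m) (`|F x|)%:E <= (e / 2)%:E)%E.
  have /(_ _ (open_ereal_lt' e2))[m _ /(_ m (leqnn m)) /ltW Hm] := integral_tail_cvg0 iF.
  by exists m.
(* The denominator is C + 1 because C may be 0. *)
have eC : (0 < (e / 2 / (C + 1))%:E)%E by rewrite lte_fin !divr_gt0// ltr_wpDl.
have /(_ _ (open_ereal_lt' eC)) AAm := AA _ (@compact_norm_le m%:R).
near=> k.
rewrite distrC -lee_fin (le_trans (key k m))// (splitr e) EFinD leeD//.
apply: (@le_trans _ _ (C%:E * (e / 2 / (C + 1))%:E)%E).
  rewrite lee_wpmul2l ?lee_fin// ltW//.
  by near: k; exact: AAm.
rewrite -EFinM lee_fin mulrCA ler_piMr//; first by rewrite divr_ge0// ltW.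
by rewrite ler_pdivrMr ?ltr_wpDl// mul1r lerDl.
Unshelve. all: by end_near. Qed.

End integral_cvg_L1loc.

(** * Integrability of the fractional divergence *)

Section boxes.
Context {R : realType}.

Lemma continuous_measurable_rV n (f : 'rV[R]_n -> R) : continuous f ->
  measurable_fun setT (f : 'rV[R]_n -> measurableTypeR R).
Proof.
move=> cf; apply: (measurability _ (RGenOpens.measurableE R)) => _ [_ [a [b ->] <-]].
rewrite setTI; apply: open_measurable_rV.
by move/continuousP : cf; apply; exact: interval_open.
Qed.

Definition box n (x : 'rV[R]_n) (r : R) : set 'rV[R]_n :=
  [set y | forall i, `|y 0 i - x 0 i| < r].

Lemma measurable_box n (x : 'rV[R]_n) (r : R) : measurable (box x r).
Proof.
have -> : box x r = \bigcap_(i in [set: 'I_n])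
    (fun y : 'rV[R]_n => y 0 i) @^-1` (ball (x 0 i : R^o) r).
  apply/seteqP; split => y /= yx i.
    by move=> _; rewrite -ball_normE /= distrC; exact: yx.
  by have := yx i I; rewrite -ball_normE /= distrC.
apply: fin_bigcap_measurable => // i _.
rewrite -[X in measurable X]setTI; apply: measurable_coord => //.
by apply: open_measurable; exact: ball_open.
Qed.

(** Induction along the recursive construction of [lebesgue_rV]: a box is an interval times a box of
    one dimension less. In dimension 0 the Dirac mass matches the empty product. *)
Lemma lebesgue_rV_box n (x : 'rV[R]_n) (r : R) : 0 < r ->
  lebesgue_rV n (box x r) = ((2 * r) ^+ n)%:E.
Proof.
move=> r0; elim: n x => [|n IH] x.
  rewrite [LHS](@diracE _ _ R) mem_set ?expr0//.
  by case.
have -> : lebesgue_rV n.+1 (box x r) =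
   (@lebesgue_measure R \x lebesgue_rV n)%E (@cons_rV R n @^-1` box x r) by [].
have -> : @cons_rV R n @^-1` box x r =
    (ball (x 0 0 : R^o) r : set (measurableTypeR R)) `*` box (uncons_rV x).2 r.
  apply/seteqP; split => [[a y]|[a y]]; rewrite -ball_normE /box /=.
    move=> ay; split; first by have := ay 0; rewrite mxE unlift_none distrC.
    by move=> i; have := ay (lift 0 i); rewrite !mxE liftK.
  move=> [xa ay] i; rewrite mxE.
  have [j ->|->] := unliftP 0 i; last by rewrite /= distrC.
  by have := ay j; rewrite mxE.
rewrite product_measure1E ?IH; [|exact: measurable_ball|exact: measurable_box].
by rewrite [X in (X * _)%E](lebesgue_measure_ball _ (ltW r0)) -EFinM exprS mulr_natl.
Qed.

End boxes.

Section euclidean_norm.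
Context {R : realType} {n : nat}.
Local Notation Rn := 'rV[R]_n.
Implicit Types u v x y : Rn.

Lemma enorm_ge0 u : 0 <= enorm u. Proof. exact: sqrtr_ge0. Qed.

Lemma coord_le_enorm u i : `|u 0 i| <= enorm u.
Proof.
rewrite -sqrtr_sqr ler_sqrt; last by apply: sumr_ge0 => j _; rewrite -expr2 sqr_ge0.
rewrite /dotmul (bigD1 i)//= -expr2 lerDl.
by apply: sumr_ge0 => j _; rewrite -expr2 sqr_ge0.
Qed.

Lemma enormN u : enorm (- u) = enorm u.
Proof. by rewrite /enorm /dotmul; under eq_bigr do rewrite !mxE mulrNN. Qed.

Lemma enorm_le u : enorm u <= n%:R * `|u|.
Proof.
rewrite -[leRHS]ger0_norm ?mulr_ge0// -sqrtr_sqr ler_sqrt ?sqr_ge0//.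
rewrite (@le_trans _ _ (\sum_(i < n) `|u| ^+ 2))//.
  apply: ler_sum => i _; rewrite -expr2 -[leLHS]real_normK ?num_real//.
  by rewrite lerXn2r ?nnegrE//; exact: coord_le_norm.
rewrite sumr_const card_ord -[leLHS]mulr_natl exprMn ler_wpM2r ?sqr_ge0//.
by rewrite -natrX ler_nat; case: n => // m; rewrite leq_pmulr.
Qed.

Lemma measurable_enorm_sub d (T : measurableType d) (f g : T -> Rn) :
  measurable_fun setT f -> measurable_fun setT g ->
  measurable_fun setT (fun t => enorm (f t - g t)).
Proof.
move=> mf mg.
have mc i (h : T -> Rn) : measurable_fun setT h ->
    measurable_fun setT (fun t => h t 0 i : measurableTypeR R).
  by move=> mh; exact: (measurableT_comp (measurable_coord i) mh).
have msqrt : measurable_fun setT (@Num.sqrt R).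
  by apply: continuous_measurable_fun; exact: sqrt_continuous.
apply: (measurableT_comp msqrt); rewrite /dotmul; apply: measurable_sum => i.
rewrite (_ : (fun _ => _) = fun t => (f t 0 i - g t 0 i) * (f t 0 i - g t 0 i)); last first.
  by apply/funext => t; rewrite !mxE.
by apply: measurable_funM; apply: measurable_funB; exact: mc.
Qed.

End euclidean_norm.

(** * Dyadic estimate of the fractional kernel *)

Section kernel.
Context {R : realType} {n : nat}.
Local Notation Rn := 'rV[R]_n.
Local Notation leb := (@lebesgue_rV R n).
Local Notation p2 t := ((2 : R) `^ t).

(* With s = n + alpha + 1, dominates the integrand of frac_div: one factor r comes
   from y - x, the minimum from the increment of a bounded Lipschitz field. *)
Definition frac_kernel (s r : R) : R := Num.min r 1 * r / r `^ s.

Lemma frac_kernel_ge0 s r : 0 <= r -> 0 <= frac_kernel s r.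
Proof. by move=> r0; rewrite !mulr_ge0// ?invr_ge0 ?powR_ge0// le_min r0 ler01. Qed.

Let p2D x y : p2 (x + y) = p2 x * p2 y.
Proof. by rewrite powRD// pnatr_eq0 implybT. Qed.

Let p2_gt0 x : 0 < p2 x.
Proof. exact: powR_gt0. Qed.

Let p2_le x y : x <= y -> p2 x <= p2 y.
Proof. by move=> xy; rewrite ler_powR// ler1n. Qed.

Let p2X x (j : nat) : p2 x ^+ j = p2 (x * j%:R).
Proof. by rewrite powRrM powR_mulrn// powR_ge0. Qed.

Lemma dyadic_ge1 (r : R) : 1 <= r -> exists j : nat, p2 j%:R <= r <= p2 (j%:R + 1).
Proof.
move=> r1.
have ex : exists j : nat, r <= p2 (j%:R + 1).
  exists (Num.bound r); rewrite natr1 powR_mulrn//.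
  have := archi_boundP (le_trans ler01 r1); move/ltW/le_trans; apply.
  by rewrite -natrX ler_nat (leq_trans (ltnW (ltnSn _)))// ltnW// ltn_expl.
(* The lower bound on r comes from the minimality of j, or from r >= 1 when j = 0. *)
exists (ex_minn ex); case: ex_minnP => -[|j] rj jmin; first by rewrite powRr0 r1.
rewrite rj andbT leNgt; apply/negP => /ltW.
by rewrite -[j.+1%:R]natr1 => /jmin; rewrite ltnn.
Qed.

Let p2_lt1 x : x < 0 -> p2 x < 1.
Proof.
rewrite -oppr_gt0 => x0; rewrite -[x]opprK powRN invf_lt1//.
have : (1 : R) `^ (- x) < 2 `^ (- x) by rewrite gt0_ltr_powR ?nnegrE// ltr1n.
by rewrite powR1.
Qed.

Lemma dyadic_le1 (r : R) : 0 < r -> r <= 1 ->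
  exists j : nat, p2 (- (j%:R + 1)) <= r <= p2 (- j%:R).
Proof.
move=> r0 r1; have [|j /andP[j1 j2]] := @dyadic_ge1 r^-1; first by rewrite invf_ge1.
exists j; rewrite !powRN; apply/andP; split.
  by rewrite -[leRHS]invrK lef_pV2 ?posrE ?invr_gt0.
by rewrite -[leLHS]invrK lef_pV2 ?posrE ?invr_gt0.
Qed.

Section dyadic_sum.
Variable s : R.
Hypothesis s0 : 0 <= s.

(* frac_kernel s r is at most near_coef j for 2^-(j+1) <= r <= 2^-j and at most
   far_coef j for 2^j <= r <= 2^(j+1). *)
Definition near_coef (j : nat) := p2 (- j%:R - j%:R + (j%:R + 1) * s).
Definition near_radius (j : nat) := p2 (- j%:R).
Definition far_coef (j : nat) := p2 (j%:R + 1 - j%:R * s).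
Definition far_radius (j : nat) := p2 (j%:R + 1).

(** Indicators of whole balls, rather than of shells, are enough for an upper bound, and only
    volumes of balls have to be estimated. *)
Definition dyadic_term (j : nat) (r : R) : R :=
  near_coef j * (r <= near_radius j)%R%:R + far_coef j * (r <= far_radius j)%R%:R.

Lemma dyadic_term_ge0 j r : 0 <= dyadic_term j r.
Proof. by rewrite addr_ge0// mulr_ge0//; exact: powR_ge0. Qed.

Lemma frac_kernel_dyadic r : 0 <= r -> exists j, frac_kernel s r <= dyadic_term j r.
Proof.
rewrite le_eqVlt => /predU1P[<-|r0].
  by exists 0%N; rewrite /frac_kernel mulr0 mul0r dyadic_term_ge0.
have rs0 t : 0 < t -> 0 < t `^ s by move=> ?; exact: powR_gt0.
have [r1|r1] := leP r 1.
  have [j /andP[j1 j2]] := dyadic_le1 r0 r1; exists j.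
  rewrite /frac_kernel min_l// /dyadic_term /near_radius j2 mulr1 ler_wpDr//.
    by rewrite mulr_ge0//; exact: powR_ge0.
  rewrite /near_coef 2!p2D ler_pM ?mulr_ge0 ?ler_pM ?(ltW r0) ?invr_ge0 ?(ltW (rs0 _ _))//.
  rewrite -[leRHS]invrK lef_pV2 ?posrE ?invr_gt0 ?rs0// -powRN -mulNr powRrM.
  by rewrite ge0_ler_powR ?nnegrE ?(ltW r0).
have [j /andP[j1 j2]] := dyadic_ge1 (ltW r1); exists j.
rewrite /frac_kernel min_r ?(ltW r1)// mul1r /dyadic_term /far_radius j2 mulr1 ler_wpDl//.
  by rewrite mulr_ge0//; exact: powR_ge0.
rewrite /far_coef p2D ler_pM ?(ltW r0) ?invr_ge0 ?(ltW (rs0 _ _))//.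
rewrite powRN lef_pV2 ?posrE ?rs0// powRrM.
by rewrite ge0_ler_powR ?nnegrE ?(ltW r0).
Qed.

End dyadic_sum.

Lemma measurable_frac_kernel s : measurable_fun setT (frac_kernel s).
Proof.
apply: measurable_funM.
  by apply: measurable_funM => //; exact: measurable_minr.
rewrite (_ : (fun _ => _) = fun r => r `^ (- s)); first exact: measurable_powR.
by apply/funext => r; rewrite powRN.
Qed.

Lemma measurable_enorm_ball (x : Rn) (r : R) : measurable [set y | enorm (y - x) <= r].
Proof.
rewrite (_ : [set _ | _] = (fun y => enorm (y - x)) @^-1` [set t | t <= r])//.
rewrite -[X in measurable X]setTI.
apply: (measurable_enorm_sub (f := id) (g := cst x)) => //.
by rewrite -set_itvNyc; exact: measurable_itv.
Qed.

(** The closed ball lies in the cube of half-side 2 * 2^t, where the extra factor 2 gives the strict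
    inequalities of [box]; the side is thus 2^(t+2). *)
Lemma lebesgue_enorm_ball (x : Rn) (t : R) :
  (leb [set y | (enorm (y - x) <= p2 t)%R] <= (p2 ((t + 2) * n%:R))%:E)%E.
Proof.
apply: (@le_trans _ _ (leb (box x (2 * p2 t)))).
  apply: le_measure; rewrite ?inE; [|exact: measurable_box|].
    exact: measurable_enorm_ball.
  move=> y /= yx i; have := coord_le_enorm (y - x) i; rewrite !mxE => yxi.
  rewrite (le_lt_trans yxi)//.
  by rewrite (le_lt_trans yx)// ltr_pMl// ltr1n.
rewrite lebesgue_rV_box ?mulr_gt0// lee_fin -p2X p2D (powR_mulrn 2)//.
by rewrite (_ : 2 * (2 * p2 t) = p2 t * 2 ^+ 2)//; ring.
Qed.

Variable alpha : R.
Hypothesis alpha01 : 0 < alpha < 1.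
Let s := n%:R + alpha + 1.

Lemma dyadic_term_indic x y j : dyadic_term s j (enorm (y - x)) =
  near_coef s j * \1_[set y : Rn | enorm (y - x) <= near_radius j] y +
  far_coef s j * \1_[set y : Rn | enorm (y - x) <= far_radius j] y.
Proof.
by rewrite /dyadic_term !indicE; congr (_ * (nat_of_bool _)%:R + _ * (nat_of_bool _)%:R);
  apply/idP/idP; rewrite inE.
Qed.

(** Coefficient times ball volume. As s = n + alpha + 1, the terms linear in j of the exponents add
    up to j (alpha - 1) for the near part and to - j alpha for the far part. *)
Lemma dyadic_term_integral x j :
  (\int[leb]_y (dyadic_term s j (enorm (y - x)))%:E <=
   (geometric (p2 (s + 2 * n%:R)) (p2 (alpha - 1)) j +
    geometric (p2 (1 + 3 * n%:R)) (p2 (- alpha)) j)%:E)%E.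
Proof.
pose S r := [set y : Rn | enorm (y - x) <= r].
have mS r : measurable (S r) by exact: measurable_enorm_ball.
have mI r : measurable_fun setT (fun y => (\1_(S r) y)%:E : \bar R).
  by apply/measurable_EFinP; exact: measurable_indic.
under eq_integral do rewrite dyadic_term_indic EFinD !EFinM.
rewrite ge0_integralD//; last 4 first.
- by move=> y _; rewrite mule_ge0// lee_fin// powR_ge0.
- by apply: emeasurable_funM => //; exact: mI.
- by move=> y _; rewrite mule_ge0// lee_fin// powR_ge0.
- by apply: emeasurable_funM => //; exact: mI.
rewrite !ge0_integralZl_EFin ?powR_ge0//; [|exact: mI..].
rewrite (@integral_indic _ _ _ leb setT measurableT (S (near_radius j)) (mS _)).
rewrite (@integral_indic _ _ _ leb setT measurableT (S (far_radius j)) (mS _)).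
rewrite !setIT EFinD leeD//.
  apply: (@le_trans _ _ ((near_coef s j)%:E * (p2 ((- j%:R + 2) * n%:R))%:E)%E).
    by rewrite lee_wpmul2l ?lee_fin ?powR_ge0// lebesgue_enorm_ball.
  rewrite -EFinM lee_fin /near_coef /geometric /= p2X -!p2D.
  by apply: p2_le; rewrite /s; lra.
apply: (@le_trans _ _ ((far_coef s j)%:E * (p2 ((j%:R + 1 + 2) * n%:R))%:E)%E).
  by rewrite lee_wpmul2l ?lee_fin ?powR_ge0// lebesgue_enorm_ball.
rewrite -EFinM lee_fin /far_coef /geometric /= p2X -!p2D.
by apply: p2_le; rewrite /s; lra.
Qed.

(** The kernel is bounded by one dyadic term, hence by the sum of all of them, which is integrated
    termwise. The two geometric series have ratios 2^(alpha-1) and 2^(-alpha), both less than 1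
    exactly because 0 < alpha < 1; the constant is the sum of the two series. *)
Lemma frac_kernel_integral : exists C : R, forall x : Rn,
  (\int[leb]_y (frac_kernel s (enorm (y - x)))%:E <= C%:E)%E.
Proof.
have [a0 a1] := andP alpha01.
have s0 : 0 <= s by rewrite /s !addr_ge0// ltW.
exists (p2 (s + 2 * n%:R) * (1 - p2 (alpha - 1))^-1 +
   p2 (1 + 3 * n%:R) * (1 - p2 (- alpha))^-1) => x.
have mker : measurable_fun setT (fun y : Rn => (frac_kernel s (enorm (y - x)))%:E).
  apply/measurable_EFinP; apply: (measurableT_comp (measurable_frac_kernel s)).
  exact: measurable_enorm_sub.
have mterm j : measurable_fun setT (fun y : Rn => (dyadic_term s j (enorm (y - x)))%:E).
  apply/measurable_EFinP.
  under eq_fun do rewrite dyadic_term_indic.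
  by apply: measurable_funD; apply: measurable_funM => //;
    apply: measurable_indic; exact: measurable_enorm_ball.
apply: (@le_trans _ _ (\int[leb]_y (\sum_(j <oo) (dyadic_term s j (enorm (y - x)))%:E))%E).
  apply: ge0_le_integral => //.
  - by move=> y _; rewrite lee_fin frac_kernel_ge0// enorm_ge0.
  - by apply: ge0_emeasurable_sum => // j y _ _; rewrite lee_fin dyadic_term_ge0.
  - move=> y _; have [j kj] := frac_kernel_dyadic s0 (enorm_ge0 (y - x)).
    apply: (@le_trans _ _ (\sum_(0 <= i < j.+1) (dyadic_term s i (enorm (y - x)))%:E)%E).
      rewrite sumEFin lee_fin big_nat_recr//= ler_wpDl//.
      by apply: sumr_ge0 => i _; exact: dyadic_term_ge0.
    by apply: nneseries_lim_ge => i _ _; rewrite lee_fin dyadic_term_ge0.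
rewrite integral_nneseries//; last by move=> j y _; rewrite lee_fin dyadic_term_ge0.
apply: lime_le.
  by apply: is_cvg_nneseries => j _ _; apply: integral_ge0 => y _; rewrite lee_fin dyadic_term_ge0.
apply: nearW => N.
apply: (@le_trans _ _ (\sum_(0 <= j < N) (geometric (p2 (s + 2 * n%:R)) (p2 (alpha - 1)) j +
    geometric (p2 (1 + 3 * n%:R)) (p2 (- alpha)) j)%:E)%E).
  by apply: lee_sum => j _; exact: dyadic_term_integral.
rewrite sumEFin lee_fin big_split lerD//.
  apply: geometric_le_lim; rewrite ?powR_ge0// gtr0_norm//.
  by apply: p2_lt1; rewrite subr_lt0.
apply: geometric_le_lim; rewrite ?powR_ge0// gtr0_norm//.
by apply: p2_lt1; rewrite oppr_lt0.
Qed.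

End kernel.

(** * Lipschitz bounds for smooth fields with compact support *)

Section smooth_bounds.
Context {R : realType} {n : nat}.
Local Notation Rn := 'rV[R]_n.
Implicit Types phi : Rn -> Rn.

Lemma continuous_compact_support_bounded (K : set Rn) (f : Rn -> Rn) :
  continuous f -> compact K -> (forall x, ~ K x -> f x = 0) ->
  exists2 B : R, 0 <= B & forall x, `|f x| <= B.
Proof.
move=> cf cK f0.
have [B HB] : exists B : R, forall y, (f @` K) y -> `|y| <= B.
  apply: compact_norm_bounded; apply: continuous_compact => //.
  exact: continuous_subspaceT.
exists `|B| => // x; have [Kx|/f0 ->] := pselect (K x); last by rewrite normr0.
by rewrite (le_trans (HB _ _) (ler_norm _))//; exists x.
Qed.

Lemma partial_off_support i phi x : ~ tsupport phi x -> partial i phi x = 0.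
Proof.
move=> sx; rewrite /partial -(derive_cst (0 : Rn) x (delta_mx 0 i : Rn)).
apply: near_eq_derive.
have : nbhs x (~` tsupport phi).
  by apply: open_nbhs_nbhs; split => //; exact/closed_openC/closed_closure.
by apply: filterS => y /tsupportPn ->.
Qed.

Lemma partial_bounded U phi : Cc_infty U phi ->
  exists2 L : R, 0 <= L & forall i x, `|partial i phi x| <= L.
Proof.
move=> [sphi ck _].
have B_ i : {B : R | 0 <= B /\ forall x, `|partial i phi x| <= B}.
  apply: cid; have [B B0 HB] : exists2 B : R, 0 <= B & forall x, `|partial i phi x| <= B.
    apply: (continuous_compact_support_bounded _ ck (@partial_off_support i phi)).
    exact: (sphi [:: i]).1.
  by exists B.
exists (\sum_i sval (B_ i)); first by apply: sumr_ge0 => i _; exact: (svalP (B_ i)).1.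
move=> i x; rewrite (bigD1 i)//= (le_trans ((svalP (B_ i)).2 x))// lerDl.
by apply: sumr_ge0 => j _; exact: (svalP (B_ j)).1.
Qed.

Lemma is_derive_line phi (j i : 'I_n) (z : Rn) (t : R) :
  derivable phi (t *: delta_mx 0 j + z) (delta_mx 0 j) ->
  is_derive t 1 (fun s : R => phi (s *: delta_mx 0 j + z) 0 i)
    (partial j phi (t *: delta_mx 0 j + z) 0 i).
Proof.
move=> dphi; apply: is_derive_cvg.
rewrite /partial derive_mx// mxE.
have /derivableP[d _] := (derivable_mxP _ _ _).1 dphi 0 i.
rewrite (_ : (fun h => _) = fun h : R => h^-1 *:
  (phi (h *: delta_mx 0 j + (t *: delta_mx 0 j + z)) 0 i -
   phi (t *: delta_mx 0 j + z) 0 i)); first exact: d.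
by apply/funext => h; rewrite -[h *: 1]/(h * 1) mulr1 scalerDl addrA.
Qed.

Lemma partial_increment U phi (L : R) (j i : 'I_n) (z : Rn) (t : R) :
  Cc_infty U phi -> (forall j x, `|partial j phi x| <= L) ->
  `|phi (t *: delta_mx 0 j + z) 0 i - phi z 0 i| <= L * `|t|.
Proof.
move=> [sphi _ _] HL.
have der z' s : derivable phi (s *: delta_mx 0 j + z') (delta_mx 0 j).
  exact: (sphi [::]).2.
(* For t < 0 the endpoints are exchanged. *)
suff pos z' s : 0 <= s -> `|phi (s *: delta_mx 0 j + z') 0 i - phi z' 0 i| <= L * s.
  have [t0|t0] := leP 0 t; first by rewrite (ger0_norm t0) pos.
  have /= := pos (t *: delta_mx 0 j + z) (- t).
  rewrite addrA -scalerDl addNr scale0r add0r distrC (ltr0_norm t0); apply.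
  by rewrite oppr_ge0 ltW.
move=> s0.
have [|c _] := MVT_segment s0 (fun x _ => is_derive_line i (der z' x)).
  by apply: derivable_within_continuous => x _; have [] := is_derive_line i (der z' x).
rewrite scale0r add0r subr0 => ->; rewrite normrM (ger0_norm s0) ler_wpM2r//.
exact: le_trans (coord_le_norm _ _) (HL _ _).
Qed.

(* Smoothness only provides partial derivatives, so the mean value theorem is
   applied with the coordinates changed one at a time. *)
Lemma Cc_infty_lipschitz U phi : Cc_infty U phi ->
  exists2 L : R, 0 <= L & forall i x y, `|phi y 0 i - phi x 0 i| <= L * enorm (y - x).
Proof.
move=> Uphi; have [L L0 HL] := partial_bounded Uphi.
exists (n%:R * L); first by rewrite mulr_ge0.
move=> i x y.
(* A path from x (m = 0) to y (m = n), changing the coordinate m in the step from m to m + 1. *)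
pose z m : Rn := \row_k (if (k < m)%N then y 0 k else x 0 k).
have -> : phi y 0 i - phi x 0 i = \sum_(0 <= m < n) (phi (z m.+1) 0 i - phi (z m) 0 i).
  rewrite telescope_sumr//; congr (phi _ 0 i - phi _ 0 i);
    apply/rowP => k; rewrite mxE ?ltn_ord//.
rewrite big_mkord (le_trans (ler_norm_sum _ _ _))//.
apply: (@le_trans _ _ (\sum_(m < n) L * enorm (y - x))); last first.
  by rewrite sumr_const card_ord -mulrA mulr_natl.
apply: ler_sum => m _.
have -> : z m.+1 = (y 0 m - x 0 m) *: delta_mx 0 m + z m.
  apply/rowP => k; rewrite !mxE eqxx /= ltnS leq_eqVlt -val_eqE /=.
  case: eqVneq => [km|km] /=; last by rewrite mulr0 add0r.
  have -> : k = m by exact: val_inj.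
  by rewrite ltnn mulr1 subrK.
rewrite (le_trans (partial_increment _ _ _ _ Uphi HL))// ler_wpM2l//.
by have := coord_le_enorm (y - x) m; rewrite !mxE.
Qed.

End smooth_bounds.

(** * Integrability and boundedness of div^alpha phi *)

Section frac_div_integrable.
Context {R : realType} {n : nat}.
Local Notation Rn := 'rV[R]_n.
Local Notation leb := (@lebesgue_rV R n).
Variables (alpha : R) (U : set Rn) (phi : Rn -> Rn).
Hypothesis alpha01 : 0 < alpha < 1.
Hypothesis Uphi : Cc_infty U phi.
Let s := n%:R + alpha + 1.
Let K := tsupport phi.

Definition frac_quot (x y : Rn) : R :=
  dotmul (y - x) (phi y - phi x) / enorm (y - x) `^ s.

(** The cutoff in the first variable only is deliberate: the integrand of div^alpha vanishes when x
    and y are both off K, so it is dominated by the sum of this kernel and its transpose. *)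
Definition local_kernel (x y : Rn) : R := \1_K x * frac_kernel s (enorm (y - x)).

Lemma local_kernel_ge0 x y : 0 <= local_kernel x y.
Proof. by rewrite mulr_ge0// frac_kernel_ge0// enorm_ge0. Qed.

Lemma frac_quot_le : exists2 C : R, 0 <= C &
  forall x y, `|frac_quot x y| <= C * (local_kernel x y + local_kernel y x).
Proof.
have [L L0 HL] := Cc_infty_lipschitz Uphi; have [sphi ck _] := Uphi.
have [B B0 HB] := continuous_compact_support_bounded (sphi [::]).1 ck (@tsupportPn _ _ phi).
(* Each coordinate of the increment of phi is at most L e for e <= 1 and at most 2 B for e > 1,
   hence at most (L + 2 B) min(e, 1); there are n coordinates. *)
pose C := n%:R * (L + B *+ 2).
have C0 : 0 <= C by rewrite mulr_ge0// addr_ge0// mulrn_wge0.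
exists C => // x y.
have e0 := enorm_ge0 (y - x); set e := enorm (y - x) in e0.
have k0 := frac_kernel_ge0 s e0.
have -> : local_kernel x y + local_kernel y x = (\1_K x + \1_K y) * frac_kernel s e.
  by rewrite mulrDl /local_kernel -(enormN (x - y)) opprB.
have [[Kx Ky]|xyK] := pselect (~ K x /\ ~ K y).
  rewrite /frac_quot (tsupportPn Kx) (tsupportPn Ky) subrr /dotmul big1 ?mul0r ?normr0.
    by rewrite mulr_ge0// mulr_ge0// addr_ge0.
  by move=> i _; rewrite [X in _ * X]mxE mulr0.
apply: (@le_trans _ _ (C * frac_kernel s e)); last first.
  rewrite ler_wpM2l// ler_peMl// !indicE.
  have [/mem_set ->|Kx] := pselect (K x); first by rewrite lerDl.
  have [/mem_set ->|Ky] := pselect (K y); first by rewrite lerDr.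
  by exfalso; exact: xyK.
rewrite /frac_quot normrM [X in _ * X]ger0_norm ?invr_ge0 ?powR_ge0// /frac_kernel mulrA.
rewrite ler_wpM2r ?invr_ge0 ?powR_ge0// /dotmul (le_trans (ler_norm_sum _ _ _))//.
apply: (@le_trans _ _ (\sum_(i < n) e * ((L + B *+ 2) * Num.min e 1))); last first.
  by rewrite sumr_const card_ord -[leLHS]mulr_natl /C le_eqVlt; apply/orP; left; apply/eqP; ring.
apply: ler_sum => i _; rewrite normrM ler_pM//; first exact: coord_le_enorm.
rewrite !mxE; have [e1|e1] := leP e 1.
  by rewrite (le_trans (HL i x y))// ler_wpM2r// lerDl mulrn_wge0.
rewrite mulr1 (le_trans (ler_normB _ _))// mulr2n ler_wpDl// lerD//;
  exact: le_trans (coord_le_norm _ _) (HB _).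
Qed.

Lemma measurable_frac_quot : measurable_fun setT (fun p : Rn * Rn => frac_quot p.1 p.2).
Proof.
have [sphi _ _] := Uphi.
have mphi i : measurable_fun setT (fun x : Rn => phi x 0 i : measurableTypeR R).
  apply: continuous_measurable_rV => x.
  apply: (@continuous_comp _ _ _ phi (fun u : Rn => u 0 i)).
    exact: (sphi [::]).1.
  exact: coord_continuous.
apply: measurable_funM.
  rewrite /dotmul; apply: measurable_sum => i.
  rewrite (_ : (fun _ => _) =
    fun p : Rn * Rn => (p.2 0 i - p.1 0 i) * (phi p.2 0 i - phi p.1 0 i)); last first.
    by apply/funext => p; rewrite !mxE.
  apply: measurable_funM; apply: measurable_funB.
  - exact: (measurableT_comp (measurable_coord i) measurable_snd).
  - exact: (measurableT_comp (measurable_coord i) measurable_fst).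
  - exact: (measurableT_comp (mphi i) measurable_snd).
  - exact: (measurableT_comp (mphi i) measurable_fst).
rewrite (_ : (fun _ => _) = fun p : Rn * Rn => enorm (p.2 - p.1) `^ (- s)); last first.
  by apply/funext => p; rewrite powRN.
apply: (measurableT_comp (measurable_powR _)).
by apply: measurable_enorm_sub; [exact: measurable_snd|exact: measurable_fst].
Qed.

Let mK : measurable K.
Proof.
rewrite -[X in measurable X]setCK; apply: measurableC; apply: open_measurable_rV.
exact/closed_openC/closed_closure.
Qed.

Lemma measurable_local_kernel : measurable_fun setT (fun p : Rn * Rn => local_kernel p.1 p.2).
Proof.
apply: measurable_funM.
  exact: (measurableT_comp (measurable_indic mK) measurable_fst).
apply: (measurableT_comp (measurable_frac_kernel s)).
by apply: measurable_enorm_sub; [exact: measurable_snd|exact: measurable_fst].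
Qed.

Lemma lebesgue_tsupport_lty : (leb K < +oo)%E.
Proof.
have [_ ck _] := Uphi; have [B HB] := compact_norm_bounded ck.
apply: (@le_lt_trans _ _ (leb (box 0 (`|B| + 1)))); last first.
  by rewrite lebesgue_rV_box ?ltry// ltr_wpDl.
apply: le_measure; rewrite ?inE; [exact: mK|exact: measurable_box|].
move=> x Kx i; rewrite mxE subr0 (le_lt_trans (coord_le_norm _ _))//.
by rewrite (le_lt_trans (HB _ Kx))// (le_lt_trans (ler_norm _))// ltrDl.
Qed.

Local Notation lk x y := (local_kernel x y)%:E.
Local Notation fq x y := (frac_quot x y)%:E.

(** Integrating in y keeps the indicator of K in the first integral, which makes it integrable in x.
    In the second one the indicator depends on y and is bounded by 1, leaving only a uniform
    bound. *)
Lemma local_kernel_bound : exists2 C : R, 0 <= C & forall x,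
  (\int[leb]_y lk x y <= C%:E * (\1_K x)%:E /\ \int[leb]_y lk y x <= C%:E)%E.
Proof.
have [C HC] := @frac_kernel_integral R n alpha alpha01.
have k0 x y : (0 <= (frac_kernel s (enorm (y - x)))%:E)%E.
  by rewrite lee_fin frac_kernel_ge0// enorm_ge0.
have mk x : measurable_fun setT (fun y : Rn => (frac_kernel s (enorm (y - x)))%:E).
  apply/measurable_EFinP; apply: (measurableT_comp (measurable_frac_kernel s)).
  exact: (measurable_enorm_sub (f := id) (g := cst x)).
have C0 : 0 <= C by rewrite -lee_fin (le_trans _ (HC 0))// integral_ge0.
exists C => // x; split.
  under eq_integral do rewrite /local_kernel EFinM.
  by rewrite ge0_integralZl_EFin// muleC lee_wpmul2r// lee_fin.
apply: (le_trans _ (HC x)); apply: ge0_le_integral => //.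
- by move=> y _; rewrite lee_fin local_kernel_ge0.
- apply/measurable_EFinP.
  exact: (measurableT_comp measurable_local_kernel (pair2_measurable x)).
- move=> y _; rewrite lee_fin /local_kernel -(enormN (x - y)) opprB ler_piMl//.
  by rewrite -lee_fin.
Qed.

Lemma frac_quot_integral_le : exists2 C : R, 0 <= C &
  (forall x, \int[leb]_y `|fq x y| <= C%:E)%E /\
  (\int[leb]_x \int[leb]_y `|fq x y| < +oo)%E.
Proof.
have [A A0 HA] := frac_quot_le; have [C C0 HC] := local_kernel_bound.
have m1 : measurable_fun setT (fun p : Rn * Rn => lk p.1 p.2).
  by apply/measurable_EFinP; exact: measurable_local_kernel.
have m2 : measurable_fun setT (fun p : Rn * Rn => lk p.2 p.1).
  by have := measurableT_comp m1 (@measurable_swap _ _ Rn Rn).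
have l0 x y : (0 <= lk x y)%E by rewrite lee_fin local_kernel_ge0.
have mI1 : measurable_fun setT (fun x => \int[leb]_y lk x y)%E.
  exact: (measurable_fun_fubini_tonelli_F _ m1 (fun p => l0 p.1 p.2)).
have mI2 : measurable_fun setT (fun x => \int[leb]_y lk y x)%E.
  exact: (measurable_fun_fubini_tonelli_F _ m2 (fun p => l0 p.2 p.1)).
have ml1 x : measurable_fun setT (fun y => lk x y).
  exact: measurableT_comp m1 (pair1_measurable x).
have ml2 x : measurable_fun setT (fun y => lk y x).
  exact: measurableT_comp m1 (pair2_measurable x).
have mfq : measurable_fun setT (fun p : Rn * Rn => fq p.1 p.2).
  by apply/measurable_EFinP; exact: measurable_frac_quot.
have mfq1 x : measurable_fun setT (fun y => fq x y).
  exact: measurableT_comp mfq (pair1_measurable x).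
have le1 x : (\int[leb]_y `|fq x y| <= A%:E * (\int[leb]_y lk x y + \int[leb]_y lk y x))%E.
  rewrite -ge0_integralD// -ge0_integralZl_EFin//; last 2 first.
  - by move=> y _; rewrite adde_ge0.
  - exact: emeasurable_funD.
  apply: ge0_le_integral => //.
  - exact: measurableT_comp.
  - by apply: emeasurable_funM => //; exact: emeasurable_funD.
  - by move=> y _; rewrite lee_fin.
exists (A * (C + C)); first by rewrite mulr_ge0// addr_ge0.
split=> [x|].
  rewrite (le_trans (le1 x))// EFinM lee_wpmul2l ?lee_fin// EFinD leeD//.
    rewrite (le_trans (HC x).1)// -EFinM lee_fin ler_piMr//.
  exact: (HC x).2.
have I0 (f : Rn -> Rn -> R) (x : Rn) :
    (forall x y, (0 <= f x y)%R) -> (0 <= \int[leb]_y (f x y)%:E)%E.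
  by move=> f0; apply: integral_ge0 => y _; rewrite lee_fin.
have mK1 : measurable_fun setT (fun x => (\1_K x)%:E : \bar R).
  by apply/measurable_EFinP; exact: measurable_indic.
have mCK : measurable_fun setT (fun x => (C%:E * (\1_K x)%:E)%E) by exact: emeasurable_funM.
(* The inner integral is at most C times the indicator of K, and K has finite measure. *)
have I1oo : (\int[leb]_x \int[leb]_y lk x y < +oo)%E.
  apply: (@le_lt_trans _ _ (\int[leb]_x (C%:E * (\1_K x)%:E))%E).
    have I1ge0 x : setT x -> (0 <= \int[leb]_y lk x y)%E.
      by move=> _; apply: I0; exact: local_kernel_ge0.
    by apply: (@ge0_le_integral _ _ R leb setT measurableT _ _ I1ge0 mI1 mCK) => x _;
      exact: (HC x).1.
  rewrite ge0_integralZl_EFin//.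
  rewrite integral_indic// setIT lte_mul_pinfty//.
  exact: lebesgue_tsupport_lty.
(* Exchanging the order of integration reduces this to the previous bound. *)
have I2oo : (\int[leb]_x \int[leb]_y lk y x < +oo)%E.
  by rewrite (fubini_tonelli (fun p : Rn * Rn => lk p.2 p.1)).
have mabs : measurable_fun setT (fun p : Rn * Rn => `|fq p.1 p.2|%E) by exact: measurableT_comp.
have mI12 : measurable_fun setT (fun x => \int[leb]_y lk x y + \int[leb]_y lk y x)%E.
  exact: emeasurable_funD mI1 mI2.
have mA : measurable_fun setT (fun x => A%:E * (\int[leb]_y lk x y + \int[leb]_y lk y x))%E.
  exact: emeasurable_funM (measurable_cst _) mI12.
have mq : measurable_fun setT (fun x => \int[leb]_y `|fq x y|)%E.
  exact: (measurable_fun_fubini_tonelli_F _ mabs (fun p => abse_ge0 _)).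
apply: (@le_lt_trans _ _ (\int[leb]_x (A%:E * (\int[leb]_y lk x y + \int[leb]_y lk y x)))%E).
  have q0 x : setT x -> (0 <= \int[leb]_y `|fq x y|)%E.
    by move=> _; apply: integral_ge0 => y _; exact: abse_ge0.
  by apply: (@ge0_le_integral _ _ R leb setT measurableT _ _ q0 mq mA) => x _; exact: le1.
have I1ge0 x : setT x -> (0 <= \int[leb]_y lk x y)%E.
  by move=> _; apply: I0; exact: local_kernel_ge0.
have I2ge0 x : setT x -> (0 <= \int[leb]_y lk y x)%E.
  by move=> _; apply: (I0 (fun x y => local_kernel y x)) => *; exact: local_kernel_ge0.
rewrite (ge0_integralZl_EFin _ measurableT
  (fun x Tx => adde_ge0 (I1ge0 x Tx) (I2ge0 x Tx)) mI12 A0).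
rewrite (ge0_integralD _ measurableT I1ge0 mI1 I2ge0 mI2).
apply: lte_mul_pinfty; [by rewrite lee_fin|exact: isT|].
exact: lte_add_pinfty I1oo I2oo.
Qed.

Lemma frac_div_integrable :
  leb.-integrable setT (EFin \o frac_div alpha phi) /\
  exists C : R, forall x, `|frac_div alpha phi x| <= C.
Proof.
have [C C0 [HC foo]] := frac_quot_integral_le.
have mfq : measurable_fun setT (fun p : Rn * Rn => fq p.1 p.2).
  by apply/measurable_EFinP; exact: measurable_frac_quot.
have ifq : (leb \x leb)%E.-integrable setT (fun p : Rn * Rn => fq p.1 p.2).
  by apply/(integrable12ltyP leb leb mfq); exact: foo.
have iF := integrable_fubini_F ifq.
have mfq1 x : measurable_fun setT (fun y => fq x y).
  exact: measurableT_comp mfq (pair1_measurable x).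
have FC x : (`|\int[leb]_y fq x y| <= C%:E)%E.
  by rewrite (le_trans (le_abse_integral _ _ _)).
(* Finiteness at every x ensures that the real-valued integral in [frac_div] is the extended one and
   not a default value. *)
have Ffin x : (\int[leb]_y fq x y)%E \is a fin_num.
  by rewrite fin_num_abs (le_lt_trans (FC x))// ltry.
have fdE x : (frac_div alpha phi x)%:E = ((@frac_const R n alpha)%:E * \int[leb]_y fq x y)%E.
  by rewrite /frac_div EFinM; congr (_ * _)%E; exact: (fineK (Ffin x)).
split.
  apply: eq_integrable (integrableZl measurableT (@frac_const R n alpha) iF) => // x _.
  by rewrite /= fdE.
exists (`|@frac_const R n alpha| * C) => x.
by rewrite -lee_fin EFinM -abse_EFin fdE abseM lee_wpmul2l.
Qed.

End frac_div_integrable.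

(** * Weak convergence and lower semicontinuity *)

Lemma le_limn_einf (R : realType) (u v : (\bar R)^nat) :
  (forall k, (u k <= v k)%E) -> (limn_einf u <= limn_einf v)%E.
Proof.
move=> uv; rewrite !limn_einf_lim; apply: lee_lim; [exact: is_cvg_einfs..|].
apply: nearW => m; apply: le_ereal_inf_tmp => _ /= [k mk <-].
by apply: ereal_inf_le; exists (u k); [exists k|].
Qed.

Section compactly_supported.
Context {R : realType} {n : nat}.
Local Notation Rn := 'rV[R]_n.
Implicit Types (phi psi : Rn -> Rn) (U V : set Rn).

Lemma tsupport_subset phi (A : set Rn) : closed A -> (forall x, ~ A x -> phi x = 0) ->
  tsupport phi `<=` A.
Proof.
move=> cA A0; rewrite [X in _ `<=` X](closure_id A).1//; apply: closure_subset => x /= /eqP phix.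
by apply: contrapT => /A0.
Qed.

Lemma Cc_lincomb U (a b : R) phi psi : Cc U phi -> Cc U psi ->
  Cc U (fun x => a *: phi x + b *: psi x).
Proof.
move=> [cphi kphi sphi] [cpsi kpsi spsi].
have sub : tsupport (fun x => a *: phi x + b *: psi x) `<=` tsupport phi `|` tsupport psi.
  apply: tsupport_subset; first by apply: closedU; exact: closed_closure.
  by move=> x /not_orP[/tsupportPn -> /tsupportPn ->]; rewrite !scaler0 addr0.
split.
- move=> x; apply: (@continuousD R Rn Rn (a \*: phi) (b \*: psi)).
    exact: continuousZl_tmp (cphi x).
  exact: continuousZl_tmp (cpsi x).
- have kU : compact (tsupport phi `|` tsupport psi) by exact: compactU.
  by apply: (subclosed_compact _ kU sub); exact: closed_closure.
- by apply: (subset_trans sub) => x [/sphi|/spsi].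
Qed.

Lemma Cc_infty_Cc U phi : Cc_infty U phi -> Cc U phi.
Proof. by move=> [sphi ck sU]; split => //; exact: (sphi [::]).1. Qed.

Lemma Cc_subset U V : U `<=` V -> Cc U `<=` @Cc R n V.
Proof. by move=> UV phi [cphi ck sU]; split => //; exact: subset_trans UV. Qed.

Lemma Cc_infty_subset U V : U `<=` V -> Cc_infty U `<=` @Cc_infty R n V.
Proof. by move=> UV phi [cphi ck sU]; split => //; exact: subset_trans UV. Qed.

Lemma Linfty_norm_le1 U phi : (forall x, enorm (phi x) <= 1) ->
  (Linfty_norm U phi <= 1)%E.
Proof.
move=> phi1; apply/ess_supP; apply: aeW => x.
by rewrite patchE; case: ifP => _; rewrite lee_fin.
Qed.

End compactly_supported.

(** * Integration of continuous fields against vector measures *)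

Section vector_integral.
Context {R : realType} {n : nat}.
Local Notation Rn := 'rV[R]_n.
Variables (Omega : set Rn) (mOmega : measurable Omega).
Implicit Types (phi psi : Rn -> Rn).

Section finite_measure.
Variable m : {finite_measure set Rn -> \bar R}.

Lemma Cc_coord_integrable phi (i : 'I_n) : Cc Omega phi ->
  m.-integrable Omega (fun x => (phi x 0 i)%:E).
Proof.
move=> [cphi ck sphi].
have [B B0 HB] := continuous_compact_support_bounded cphi ck (@tsupportPn _ _ phi).
apply: (measurable_bounded_integrable (f := fun x => phi x 0 i)) => //.
- by rewrite ltey_eq fin_num_measure.
- apply: measurable_funTS; apply: continuous_measurable_rV => x.
  apply: (@continuous_comp _ _ _ phi (fun u : Rn => u 0 i)); first exact: cphi.
  exact: coord_continuous.
- exists B; split; first exact: num_real.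
  move=> M BM x _ /=; rewrite (le_trans (coord_le_norm _ _))//.
  by rewrite (le_trans (HB x))// ltW.
Qed.

Lemma Rintegral_coord_bound phi (i : 'I_n) (b : R) : Cc Omega phi ->
  (forall x, `|phi x| <= b) ->
  `|\int[m]_(x in Omega) phi x 0 i| <= fine (m Omega) * b.
Proof.
move=> Cphi phib; have iphi := Cc_coord_integrable i Cphi.
rewrite (le_trans (le_normr_Rintegral mOmega iphi))// mulrC -Rintegral_cst//.
apply: le_Rintegral => //.
- exact: (integrable_norm iphi).
- by apply: finite_measure_integrable_cst.
- by move=> x _; rewrite (le_trans (coord_le_norm _ _)).
Qed.

End finite_measure.

Lemma charge_integral_lincomb (mu : {charge set Rn -> \bar R}) (i : 'I_n) (a b : R) phi psi :
  Cc Omega phi -> Cc Omega psi ->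
  charge_integral Omega mu (fun x => (a *: phi x + b *: psi x) 0 i) =
  a * charge_integral Omega mu (fun x => phi x 0 i) +
  b * charge_integral Omega mu (fun x => psi x 0 i).
Proof.
move=> Cphi Cpsi.
have lin (m : {finite_measure set Rn -> \bar R}) :
    \int[m]_(x in Omega) (a *: phi x + b *: psi x) 0 i =
    a * (\int[m]_(x in Omega) phi x 0 i) + b * (\int[m]_(x in Omega) psi x 0 i).
  have iphi := Cc_coord_integrable m i Cphi.
  have ipsi := Cc_coord_integrable m i Cpsi.
  rewrite -!RintegralZl// -RintegralD//; last 2 first.
  - by apply: eq_integrable (integrableZl mOmega a iphi) => // x _; rewrite -EFinM.
  - by apply: eq_integrable (integrableZl mOmega b ipsi) => // x _; rewrite -EFinM.
  by apply: eq_Rintegral => x _; rewrite !mxE.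
by rewrite /charge_integral !lin; ring.
Qed.

Lemma vintegral_lincomb (mu : vmeasure) (a b : R) phi psi :
  Cc Omega phi -> Cc Omega psi ->
  vintegral Omega (fun x => a *: phi x + b *: psi x) mu =
  a * vintegral Omega phi mu + b * vintegral Omega psi mu.
Proof.
move=> Cphi Cpsi; rewrite /vintegral !mulr_sumr -big_split /=.
by apply: eq_bigr => i _; rewrite charge_integral_lincomb.
Qed.

(** Continuity for the sup norm; the constant adds up the masses on Omega of the Jordan parts of all
    components. *)
Lemma vintegral_bound (mu : vmeasure) : exists2 C : R, 0 <= C &
  forall phi b, Cc Omega phi -> (forall x, `|phi x| <= b) ->
    `|vintegral Omega phi mu| <= C * b.
Proof.
pose p i := fine (jordan_pos (svalP (hahn_pn (mu i))) Omega).
pose q i := fine (jordan_neg (svalP (hahn_pn (mu i))) Omega).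
exists (\sum_(i < n) (p i + q i)).
  by apply: sumr_ge0 => i _; rewrite addr_ge0// fine_ge0.
move=> phi b Cphi phib; rewrite /vintegral (le_trans (ler_norm_sum _ _ _))// mulr_suml.
apply: ler_sum => i _; rewrite (le_trans (ler_normB _ _))// mulrDl lerD//;
  exact: Rintegral_coord_bound.
Qed.

End vector_integral.

(** * From smooth to continuous test fields *)

Section weak_convergence.
Context {R : realType} {n : nat}.
Local Notation Rn := 'rV[R]_n.
Implicit Types (phi psi theta : Rn -> Rn) (U Omega K : set Rn).

Lemma compact_open_between K Omega : compact K -> open Omega -> K `<=` Omega ->
  exists U, [/\ open U, compact (closure U), closure U `<=` Omega & K `<=` U].
Proof.
move=> cK oO KO; have [d d0 Hd] := compact_open_margin cK oO KO.
have [B HB] := compact_norm_bounded cK.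
have d2 : 0 < d / 2 by rewrite divr_gt0.
(* With radius d / 2, points of the closure of U are still at distance less than d from K. *)
pose U := \bigcup_(x in K) ball x (d / 2).
have clU y : closure U y -> exists2 x, K x & `|x - y| < d.
  have /cvgrPdist_lt/(_ _ d2) yd : id x @[x --> y] --> (y : Rn) by exact: cvg_id.
  move=> /(_ _ yd)[z [[x Kx xz] /= yz]]; exists x => //.
  rewrite -(subrK z x) -addrA (le_lt_trans (ler_normD _ _))// (splitr d) ltrD//.
    by move: xz; rewrite -ball_normE.
  by rewrite distrC.
exists U; split.
- by apply: bigcup_open => x _; exact: ball_open.
- apply: bounded_closed_compact; last exact: closed_closure.
  exists (B + d); split; first exact: num_real.
  move=> M BM y /clU[x Kx xy]; rewrite /= (le_trans _ (ltW BM))//.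
  rewrite -(subrK x y) addrC (le_trans (ler_normD _ _))// lerD ?HB//.
  by rewrite distrC ltW.
- by move=> y /clU[x Kx xy]; exact: Hd xy.
- by move=> x Kx; exists x => //; exact: ballxx.
Qed.

Variables (alpha : R) (Omega : set Rn).
Hypothesis oOmega : open Omega.

Let mOmega : measurable Omega. Proof. exact: open_measurable_rV. Qed.

(* The perimeter only tests against smooth fields; by density and continuity of
   the integral against a fixed measure, it controls continuous fields too. *)
Lemma vintegral_le_perimeter (E U : set Rn) (mu : vmeasure) (M : R) :
  open U -> U `<=` Omega -> is_frac_variation alpha Omega E mu ->
  (frac_perimeter alpha U E <= M%:E)%E ->
  forall theta b, 0 < b -> Cc U theta -> (forall x, `|theta x| <= b) ->
    `|vintegral Omega theta mu| <= 2 * n.+1%:R * M * b.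
Proof.
move=> oU UO [_ muE] EM.
(* The approximation psi below has sup norm at most 2 b0 = 1/(n+1), hence Euclidean norm at most
   n/(n+1) <= 1. Using n + 1 covers dimension 0. *)
pose b0 : R := (2 * n.+1%:R)^-1.
have b00 : 0 < b0 by rewrite invr_gt0 mulr_gt0.
have [C C0 HC] := vintegral_bound mOmega mu.
have upper theta : Cc U theta -> (forall x, `|theta x| <= b0) ->
    - vintegral Omega theta mu <= M.
  move=> Utheta thetab; apply/ler_addgt0Pr => e e0.
  (* The bound b0 keeps psi admissible in the perimeter; the other one makes the integrals of psi
     and theta differ by at most e. *)
  pose eta := Num.min b0 (e / (C + 1)).
  have eta0 : 0 < eta by rewrite lt_min b00 divr_gt0// ltr_wpDl.
  have [psi Upsi psi_theta] := Cc_infty_dense oU Utheta eta0.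
  have psiM : - vintegral Omega psi mu <= M.
    rewrite -muE; last exact: Cc_infty_subset Upsi.
    rewrite -lee_fin; apply: le_trans EM; apply: ereal_sup_ubound; exists psi => //; split => //.
    apply: Linfty_norm_le1 => x; rewrite (le_trans (enorm_le _))//.
    have : `|psi x| <= n.+1%:R^-1.
      rewrite -(subrK (theta x) (psi x)) (le_trans (ler_normD _ _))//.
      have -> : n.+1%:R^-1 = b0 + b0 :> R.
        by rewrite /b0 invfM mulrC; exact: splitr.
      by rewrite lerD// (le_trans (psi_theta x))// ge_min lexx.
    move=> /(ler_wpM2l (ler0n R n)) /le_trans; apply.
    by rewrite ler_pdivrMr// mul1r ler_nat.
  have Cpsi : Cc Omega psi by apply: (Cc_subset UO); exact: Cc_infty_Cc.
  have Ctheta : Cc Omega theta by exact: (Cc_subset UO).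
  have := HC (fun x => 1 *: psi x + (-1) *: theta x) eta (Cc_lincomb 1 (-1) Cpsi Ctheta).
  rewrite vintegral_lincomb// mul1r mulN1r => /(_ _)/ler_normlW H.
  have {}H : vintegral Omega psi mu - vintegral Omega theta mu <= C * eta.
    by apply: H => x; rewrite scale1r scaleN1r.
  have Ce : C * eta <= e.
    apply: (@le_trans _ _ (C * (e / (C + 1)))).
      by rewrite ler_wpM2l// ge_min lexx orbT.
    rewrite mulrCA ler_piMr ?(ltW e0)// ler_pdivrMr ?ltr_wpDl// mul1r lerDl//.
  by lra.
move=> theta b b_gt0 Utheta thetab.
pose c := b0 / b.
have c0 : 0 < c by rewrite divr_gt0.
have Ctheta : Cc Omega theta by exact: (Cc_subset UO).
(* Applied to a = c and a = - c, this bounds the absolute value. *)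
have scaled a : `|a| = c -> - (a * vintegral Omega theta mu) <= M.
  move=> ac; have := upper (fun x => a *: theta x + 0 *: theta x) (Cc_lincomb a 0 Utheta Utheta).
  rewrite vintegral_lincomb// mul0r addr0; apply => x.
  rewrite scale0r addr0 normrZ ac (le_trans (ler_wpM2l (ltW c0) (thetab x)))//.
  by rewrite /c divfK// gt_eqF.
have : c * `|vintegral Omega theta mu| <= M.
  rewrite -[c](gtr0_norm c0) -normrM ler_norml lerNl.
  apply/andP; split; first by rewrite scaled// gtr0_norm.
  by have := scaled (- c); rewrite normrN gtr0_norm// mulNr opprK; exact.
rewrite -ler_pdivlMl// => /le_trans; apply.
rewrite /c /b0 invfM !invrK le_eqVlt; apply/orP; left; apply/eqP; ring.
Qed.

Lemma weak_cvg_perimeter (E_ : nat -> set Rn) (mu_ : nat -> vmeasure) (mu : vmeasure) :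
  (forall k, is_frac_variation alpha Omega (E_ k) (mu_ k)) ->
  (forall U : set Rn, open U -> compact (closure U) -> closure U `<=` Omega ->
     (ereal_sup (range (fun k => frac_perimeter alpha U (E_ k))) < +oo)%E) ->
  (forall psi, Cc_infty Omega psi ->
     vintegral Omega psi (mu_ k) @[k --> \oo] --> vintegral Omega psi mu) ->
  weak_cvg Omega mu_ mu.
Proof.
move=> muE bnd cvg_smooth phi Ophi; have [cphi ck sO] := Ophi.
have [U [oU cU clUO KU]] := compact_open_between ck oOmega sO.
have UO : U `<=` Omega by apply: subset_trans clUO; exact: subset_closure.
have Uphi : Cc U phi by [].
have [M M0 HM] : exists2 M : R, 0 <= M & forall k, (frac_perimeter alpha U (E_ k) <= M%:E)%E.
  have := bnd U oU cU clUO; set S := ereal_sup _ => Soo.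
  have PS k : (frac_perimeter alpha U (E_ k) <= S)%E.
    by apply: ereal_sup_ubound; exists k.
  exists `|fine S| => // k; apply: (le_trans (PS k)).
  by move: Soo; case: S PS => [r| |] _ //= _; rewrite ?leNye// lee_fin ler_norm.
have [C C0 HC] := vintegral_bound mOmega mu.
apply/cvgrPdist_le => e e0.
pose A : R := 2 * n.+1%:R * M.
have A0 : 0 <= A by rewrite !mulr_ge0.
(* A bounds the functionals of all the [mu_ k] on fields supported in U, C that of the limit [mu];
   replacing phi by psi costs at most (A + C) b <= e / 2 in total. *)
pose b := e / 2 / (A + C + 1).
have AC : 0 < A + C + 1 by rewrite ltr_wpDl// addr_ge0.
have b0 : 0 < b by rewrite !divr_gt0.
have bAC : A * b + C * b <= e / 2.
  rewrite -mulrDl /b mulrCA ler_piMr ?divr_ge0 ?(ltW e0)// ler_pdivrMr// mul1r lerDl//.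
have [psi Upsi psi_phi] := Cc_infty_dense oU Uphi b0.
have Opsi : Cc_infty Omega psi := Cc_infty_subset UO Upsi.
have /cvgrPdist_le/(_ (e / 2)) := cvg_smooth _ Opsi.
rewrite divr_gt0// => /(_ isT); apply: filterS => k kpsi.
pose theta x := 1 *: phi x + (-1) *: psi x.
have Utheta : Cc U theta by apply: Cc_lincomb => //; exact: Cc_infty_Cc.
have Otheta : Cc Omega theta by exact: (Cc_subset UO).
have theta_b x : `|theta x| <= b by rewrite /theta scale1r scaleN1r distrC.
have thetaE nu : vintegral Omega theta nu = vintegral Omega phi nu - vintegral Omega psi nu.
  by rewrite vintegral_lincomb//; [rewrite mul1r mulN1r|exact: Cc_infty_Cc].
have := vintegral_le_perimeter oU UO (muE k) (HM k) b0 Utheta theta_b.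
have := HC _ _ Otheta theta_b; rewrite !thetaE => h1 h2.
(* Three terms: phi - psi against [mu], bounded through C; psi against [mu] and [mu_ k], small by
   convergence on smooth fields; phi - psi against [mu_ k], bounded through A uniformly in k. *)
rewrite (_ : vintegral Omega phi mu - vintegral Omega phi (mu_ k) =
   (vintegral Omega phi mu - vintegral Omega psi mu) +
   ((vintegral Omega psi mu - vintegral Omega psi (mu_ k)) -
   (vintegral Omega phi (mu_ k) - vintegral Omega psi (mu_ k)))); last by ring.
rewrite (le_trans (ler_normD _ _))// (le_trans (lerD (lexx _) (ler_normB _ _)))//.
rewrite (splitr e) -[A]/A in bAC *.
by apply: le_trans (lerD h1 (lerD kpsi h2)) _; rewrite -/A; lra.
Qed.

End weak_convergence.

Lemma int_frac_div_cvg (R : realType) (n : nat) (alpha : R)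
    (Omega : set 'rV[R]_n) (E_ : nat -> set 'rV[R]_n) (E : set 'rV[R]_n)
    (phi : 'rV[R]_n -> 'rV[R]_n) :
  0 < alpha < 1 ->
  (forall k, lebesgue_measurable (E_ k)) -> lebesgue_measurable E ->
  cvg_L1loc (fun k => \1_(E_ k)) (\1_E) -> Cc_infty Omega phi ->
  int_frac_div alpha (E_ k) phi @[k --> \oo] --> int_frac_div alpha E phi.
Proof.
move=> alpha01 mE_ mE EE Ophi; have [iF [C HC]] := frac_div_integrable alpha01 Ophi.
exact: cvg_Rintegral_L1loc iF HC mE_ mE EE.
Qed.

(* The weak convergence clause comes in two parts: convergence of the measures
   D^alpha chi_{E_k} to the distribution D^alpha chi_E, with no further
   assumption, and convergence against all of C_c(Omega; R^n) as soon as
   D^alpha chi_E is a measure and the perimeters of the E_k are locally bounded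
   in Omega; by uniform boundedness, the latter is necessary. *)
Theorem proposition4p3 (R : realType) (n : nat) (alpha : R)
    (Omega : set 'rV[R]_n) (E_ : nat -> set 'rV[R]_n) (E : set 'rV[R]_n) :
  0 < alpha < 1 ->
  open Omega ->
  (forall k, lebesgue_measurable (E_ k)) ->
  lebesgue_measurable E ->
  (forall k, finite_frac_perimeter alpha Omega (E_ k)) ->
  cvg_L1loc (fun k => \1_(E_ k)) (\1_E) ->
  (forall mu_ : nat -> vmeasure,
     (forall k, is_frac_variation alpha Omega (E_ k) (mu_ k)) ->
     (forall phi, Cc_infty Omega phi ->
        vintegral Omega phi (mu_ k) @[k --> \oo] -->
          - int_frac_div alpha E phi) /\
     ((forall U : set 'rV[R]_n, open U -> compact (closure U) ->
         closure U `<=` Omega ->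
         (ereal_sup (range (fun k => frac_perimeter alpha U (E_ k))) < +oo)%E) ->
      forall mu : vmeasure, is_frac_variation alpha Omega E mu ->
        weak_cvg Omega mu_ mu)) /\
  (frac_perimeter alpha Omega E <=
     limn_einf (fun k => frac_perimeter alpha Omega (E_ k)))%E.
Proof.
move=> alpha01 oOmega mE_ mE _ EE.
have cvg_div phi := int_frac_div_cvg alpha01 mE_ mE EE (phi := phi) (Omega := Omega).
split=> [mu_ muE|].
  have cvg_smooth phi : Cc_infty Omega phi ->
      vintegral Omega phi (mu_ k) @[k --> \oo] --> - int_frac_div alpha E phi.
    move=> Ophi; under eq_fun => k do rewrite -[vintegral _ _ _]opprK -(muE k).2//.
    by apply: cvgN; exact: cvg_div.
  split=> // bnd mu [_ muEE]; apply: (weak_cvg_perimeter oOmega muE bnd) => psi Opsi.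
  by rewrite -[vintegral Omega psi mu]opprK -muEE//; exact: cvg_smooth.
(* For a fixed admissible phi, the value at E is the limit, hence the lower limit, of the values at
   the E_k, each of which is below the perimeter of E_k. *)
apply: ge_ereal_sup => _ [phi [Ophi phi1] <-].
have /cvg_limn_einf_sup[<- _] :
    (int_frac_div alpha (E_ k) phi)%:E @[k --> \oo] --> (int_frac_div alpha E phi)%:E.
  by apply: cvg_EFin; [exact: nearW|exact: cvg_div].
by apply: le_limn_einf => k; apply: ereal_sup_ubound; exists phi.
Qed.
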